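(* Let $K$ be a field, $R=K[\![x,y,z]\!]$, let $u,v,w\ge 0$ be integers, let $$h=\bigl(1,3,3,\underbrace{3,\ldots,3}_{u},\underbrace{2,\ldots,2}_{v},\underbrace{1,\ldots,1}_{w},1\bigr)$$ be an O-sequence, and let $s=u+v+w+3$. Let $I\subseteq R$ be a Gorenstein ideal such that $R/I$ has Hilbert function $h$. Let $\mathfrak D_1=(\mathfrak D(0),\mathfrak D(w),\mathfrak D(w+v))$, where $$\mathfrak D(0)=(1,1,\ldots,1,1)\ \text{(ones exactly in positions } 0,\ldots,s),$$ $$\mathfrak D(w)=(0,1,1,\ldots,1)\ \text{(ones exactly in positions } 1,\ldots,u+v+2),$$ $$\mathfrak D(w+v)=(0,1,1,\ldots,1)\ \text{(ones exactly in positions } 1,\ldots,u+2),$$ all other $\mathfrak D(a)$ being zero, with the understanding that if $w=0$ then $\mathfrak D(0)$ and $\mathfrak D(w)$ are replaced by a single vector which is their sum, if $v=0$ then the same happens for $\mathfrak D(w)$ and $\mathfrak D(v+w)$, and if $w=v=0$ then the symmetric decomposition consists of a single $\mathfrak D(0)$ which is the sum of the three. Then: (a) if $I$ is additionally a complete intersection ideal, then its symmetric decomposition is unique and given by $\mathfrak D_1$; (b) if $\Delta(h)=2$, then the symmetric decomposition of $I$ is $\mathfrak D_1$; (c) if $\Delta(h)=1$, then the symmetric decomposition of $I$ is either $\mathfrak D_1$ or $\mathfrak D_2$, where $\mathfrak D_2$ is the following: let $\delta=(0,1)$ and let $(\mathfrak D(0),\mathfrak D(1),\ldots,\mathfrak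 D(s-2))$ be the unique symmetric decomposition of $h-\delta$; then $$\mathfrak D_2=(\mathfrak D(0),\mathfrak D(1),\ldots,\mathfrak D(s-2)+\delta).$$
   Context: For an Artinian local $K$-algebra $(A,\mathfrak m)$ with $A/\mathfrak m\simeq K$, the Hilbert function is $\mathrm{HF}_A(t)=\dim_K\mathfrak m^t/\mathfrak m^{t+1}$, written as a vector $(h_0,\ldots,h_s)$, where the socle degree $s$ is the largest $j$ with $\mathfrak m^j\neq0$. An O-sequence is a sequence satisfying Macaulay's bound, i.e. a Hilbert function of a standard graded $K$-algebra. $\Delta(h)=\max\{|h_i-h_{i-1}|: i=3,\ldots,s\}$. An ideal $I\subseteq R$ is a Gorenstein (resp. complete intersection) ideal if $R/I$ is an Artinian Gorenstein (resp. Artinian complete intersection) ring. Vectors are indexed from position $0$ and padded with zeros; $\delta=(0,1)$ has a single $1$ in position $1$. Symmetric decomposition: let $(A,\mathfrak m)$ be Artinian Gorenstein local of socle degree $s$, with associated graded ring $G=\bigoplus_{i\ge0}\mathfrak m^i/\mathfrak m^{i+1}$. There is a descending filtration by ideals $G=C(0)\supseteq C(1)\supseteq\cdots\supseteq C(s)=0$, where $$C(a)_i=\frac{(0:\mathfrak m^{s+1-a-i})\cap \mathfrak m^i}{(0:\mathfrak m^{s+1-a-i})\cap\mathfrak m^{i+1}}$$ (with $\mathfrak m^j=A$ for $j\le 0$). Put $Q(a)=C(a)/C(a+1)$ and let $\mathfrak D(a)$ be the Hilbert function of $Q(a)$; it is symmetric about $\frac{s-a}{2}$, and $\mathrm{HF}_A=\sum_a\mathfrak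 D(a)$. The symmetric decomposition of $A$ is $(\mathfrak D(0),\mathfrak D(1),\ldots,\mathfrak D(s-2))$; the symmetric decomposition of an ideal $I$ is that of $R/I$. In codimension two, a sequence $(1,2,h_2,\ldots,h_s=1)$ is the Hilbert function of an Artinian Gorenstein quotient of $K[\![x,y]\!]$ if and only if $|h_i-h_{i-1}|\le 1$ for all $i=1,\ldots,s$, and in that case all such quotients have the same symmetric decomposition (Iarrobino); this is what is meant by ''the unique symmetric decomposition of $h-\delta$''. *)

(* Defs.v *)
From HB Require Import structures.
From mathcomp Require Import all_boot all_order all_algebra ring_quotient.
From mathcomp Require Import mpoly.
From mathcomp Require Import boolp classical_sets.

Set Implicit Arguments.
Unset Strict Implicit.
Unset Printing Implicit Defensive.

Import GRing.Theory.
Local Open Scope ring_scope.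
Local Open Scope classical_set_scope.

(* K[[x_0, ..., x_(n-1)]]. The family of coefficients is wrapped in a record   *)
(* so that it does not inherit the pointwise product of functions.            *)

Record powerseries (n : nat) (K : fieldType) :=
  PowerSeries { pscoef : 'X_{1..n} -> K }.

Notation "{ 'powerseries' K [ n ] }" := (powerseries n K)
  (at level 0, K, n at level 2, format "{ 'powerseries'  K [ n ] }").

Section PowerSeriesRing.
Variables (n : nat) (K : fieldType).
Local Notation PS := {powerseries K[n]}.
Implicit Types f g h : PS.

Lemma powerseriesP f g : (forall m, pscoef f m = pscoef g m) -> f = g.
Proof. by case: f g => [f] [g] /= fg; congr PowerSeries; apply/funext. Qed.

HB.instance Definition _ := gen_eqMixin PS.
HB.instance Definition _ := gen_choiceMixin PS.

Definition ps_zero : PS := PowerSeries (fun=> 0).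
Definition ps_opp f : PS := PowerSeries (fun m => - pscoef f m).
Definition ps_add f g : PS := PowerSeries (fun m => pscoef f m + pscoef g m).
Definition ps_one : PS := PowerSeries (fun m => (m == 0%MM)%:R).
Definition ps_mul f g : PS :=
  PowerSeries (fun m =>
    \sum_(k : 'X_{1..n < (mdeg m).+1} * 'X_{1..n < (mdeg m).+1}
           | m == (k.1 + k.2)%MM) pscoef f k.1 * pscoef g k.2).
Definition ps_scale (c : K) f : PS := PowerSeries (fun m => c * pscoef f m).

Fact ps_addA : associative ps_add.
Proof. by move=> f g h; apply: powerseriesP => m; apply: addrA. Qed.
Fact ps_addC : commutative ps_add.
Proof. by move=> f g; apply: powerseriesP => m; apply: addrC. Qed.
Fact ps_add0 : left_id ps_zero ps_add.
Proof. by move=> f; apply: powerseriesP => m; apply: add0r. Qed.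
Fact ps_addN : left_inverse ps_zero ps_opp ps_add.
Proof. by move=> f; apply: powerseriesP => m; apply: addNr. Qed.

HB.instance Definition _ :=
  GRing.isZmodule.Build PS ps_addA ps_addC ps_add0 ps_addN.

(* The polynomial made of the terms of degree < d of f; the ring axioms are   *)
(* transported from {mpoly K[n]} through it.                                  *)
Definition ps_trunc d f : {mpoly K[n]} :=
  \sum_(k : 'X_{1..n < d}) pscoef f k *: 'X_[k].

Lemma mcoeff_ps_trunc d f m :
  (mdeg m < d)%N -> (ps_trunc d f)@_m = pscoef f m.
Proof.
move=> lt_md; rewrite /ps_trunc raddf_sum /= (bigD1 (BMultinom lt_md)) //=.
rewrite mcoeffZ mcoeffX eqxx mulr1 big1 ?addr0 // => k.
by rewrite -val_eqE /= mcoeffZ mcoeffX => /negPf->; rewrite mulr0.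
Qed.

Lemma mcoeffM_low (p q p' q' : {mpoly K[n]}) m :
  (forall k, (mdeg k <= mdeg m)%N -> p@_k = p'@_k) ->
  (forall k, (mdeg k <= mdeg m)%N -> q@_k = q'@_k) ->
  (p * q)@_m = (p' * q')@_m.
Proof.
move=> pp qq; rewrite !mcoeffM; apply: eq_bigr => -[k1 k2] _ /=.
by rewrite pp ?qq // -ltnS bmdeg.
Qed.

Lemma ps_mulE d f g m : (mdeg m < d)%N ->
  pscoef (ps_mul f g) m = (ps_trunc d f * ps_trunc d g)@_m.
Proof.
move=> lt_md; rewrite mcoeffM; apply: eq_bigr => -[k1 k2] _ /=.
have lt_kd (k : 'X_{1..n < (mdeg m).+1}) : (mdeg k < d)%N.
  exact: leq_trans (bmdeg k) _.
by rewrite !mcoeff_ps_trunc ?lt_kd.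
Qed.

Lemma mcoeff_trunc_mul d f g m : (mdeg m < d)%N ->
  (ps_trunc d (ps_mul f g))@_m = (ps_trunc d f * ps_trunc d g)@_m.
Proof. by move=> lt_md; rewrite mcoeff_ps_trunc // (ps_mulE _ _ lt_md). Qed.

Fact ps_mulA : associative ps_mul.
Proof.
move=> f g h; apply: powerseriesP => m; rewrite !(ps_mulE _ _ (ltnSn (mdeg m))).
set T := ps_trunc _; have -> : (T f * T (ps_mul g h))@_m = (T f * (T g * T h))@_m.
  by apply: mcoeffM_low => // k le_km; rewrite /T mcoeff_trunc_mul.
rewrite mulrA; apply: mcoeffM_low => // k le_km.
by rewrite /T mcoeff_trunc_mul.
Qed.

Fact ps_mulC : commutative ps_mul.
Proof.
move=> f g; apply: powerseriesP => m.
by rewrite !(ps_mulE _ _ (ltnSn (mdeg m))) mulrC.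
Qed.

Fact ps_mul1 : left_id ps_one ps_mul.
Proof.
move=> f; apply: powerseriesP => m; rewrite (ps_mulE _ _ (ltnSn (mdeg m))).
rewrite -[RHS](mcoeff_ps_trunc f (ltnSn (mdeg m))) -[in RHS](mul1r (ps_trunc _ f)).
by apply: mcoeffM_low => // k le_km; rewrite mcoeff_ps_trunc // mcoeff1.
Qed.

Fact ps_mulDl : left_distributive ps_mul +%R.
Proof.
move=> f g h; apply: powerseriesP => m /=; rewrite -big_split /=.
by apply: eq_bigr => k _; rewrite mulrDl.
Qed.

Fact ps_one_neq0 : ps_one != 0.
Proof.
apply/eqP => /(congr1 (fun f => pscoef f 0%MM)) /= /eqP.
by rewrite eqxx oner_eq0.
Qed.

HB.instance Definition _ := GRing.Zmodule_isComNzRing.Build PS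
  ps_mulA ps_mulC ps_mul1 ps_mulDl ps_one_neq0.

Fact ps_scaleA a b f : ps_scale a (ps_scale b f) = ps_scale (a * b) f.
Proof. by apply: powerseriesP => m; apply: mulrA. Qed.
Fact ps_scale1 : left_id 1 ps_scale.
Proof. by move=> f; apply: powerseriesP => m; apply: mul1r. Qed.
Fact ps_scaleDr : right_distributive ps_scale +%R.
Proof. by move=> a f g; apply: powerseriesP => m; apply: mulrDr. Qed.
Fact ps_scaleDl f : {morph ps_scale^~ f : a b / a + b}.
Proof. by move=> a b; apply: powerseriesP => m; apply: mulrDl. Qed.

HB.instance Definition _ := GRing.Zmodule_isLmodule.Build K PS
  ps_scaleA ps_scale1 ps_scaleDr ps_scaleDl.

Fact ps_scaleAl (a : K) f g : a *: (f * g) = a *: f * g.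
Proof.
apply: powerseriesP => m /=; rewrite mulr_sumr.
by apply: eq_bigr => k _; rewrite mulrA.
Qed.

HB.instance Definition _ := GRing.Lmodule_isLalgebra.Build K PS ps_scaleAl.
HB.instance Definition _ := GRing.Lalgebra_isComAlgebra.Build K PS.

End PowerSeriesRing.

(* The library equips {ideal_quot I} with a ring structure only; for an ideal *)
(* I of K[[x_0, ..., x_(n-1)]] it is a K-algebra. Since predicates are        *)
(* decidable classically, idealr covers all the proper ideals.                *)

Section QuotientAlgebra.
Variables (n : nat) (K : fieldType) (I : idealr {powerseries K[n]}).
Local Notation R := {powerseries K[n]}.
Local Notation Q := {ideal_quot I}.
Local Open Scope quotient_scope.

Definition iq_scale (c : K) (x : Q) : Q := \pi_Q (c%:A) * x.

Let piD (f g : R) : \pi_Q (f + g) = \pi_Q f + \pi_Q g.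
Proof. by rewrite !piE. Qed.
Let piM (f g : R) : \pi_Q (f * g) = \pi_Q f * \pi_Q g.
Proof. by rewrite !piE. Qed.
Let pi1 : \pi_Q 1 = 1.
Proof. by rewrite !piE. Qed.

Fact iq_scaleA a b x : iq_scale a (iq_scale b x) = iq_scale (a * b) x.
Proof. by rewrite /iq_scale mulrA -piM -scalerAl mul1r scalerA. Qed.
Fact iq_scale1 : left_id 1 iq_scale.
Proof. by move=> x; rewrite /iq_scale scale1r pi1 mul1r. Qed.
Fact iq_scaleDr : right_distributive iq_scale +%R.
Proof. by move=> a x y; rewrite /iq_scale mulrDr. Qed.
Fact iq_scaleDl x : {morph iq_scale^~ x : a b / a + b}.
Proof. by move=> a b; rewrite /iq_scale scalerDl piD mulrDl. Qed.

HB.instance Definition _ := GRing.Zmodule_isLmodule.Build K Q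
  iq_scaleA iq_scale1 iq_scaleDr iq_scaleDl.

Fact iq_scaleAl (a : K) (x y : Q) : a *: (x * y) = a *: x * y.
Proof. exact: mulrA. Qed.

HB.instance Definition _ := GRing.Lmodule_isLalgebra.Build K Q iq_scaleAl.
HB.instance Definition _ := GRing.Lalgebra_isComAlgebra.Build K Q.

End QuotientAlgebra.


Section CommutativeRing.
Variable A : comNzRingType.
Implicit Types (J L : set A) (x y : A).

Definition is_ideal J : Prop :=
  [/\ J 0, forall x y, J x -> J y -> J (x + y) & forall a x, J x -> J (a * x)].

Definition artinian : Prop :=
  forall F : nat -> set A, (forall i, is_ideal (F i)) ->
    (forall i, F i.+1 `<=` F i) ->
  exists N, forall i, (N <= i)%N -> F i = F N.

Definition nonunits : set A := [set x | ~ exists y, x * y = 1].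

(* A is local iff its nonunits form an ideal, which is then the maximal ideal *)
Definition local_ring : Prop := is_ideal nonunits.

Definition ideal_mul J L : set A :=
  [set x | exists s : seq (A * A),
     (forall p, p \in s -> J p.1 /\ L p.2) /\ x = \sum_(p <- s) p.1 * p.2].

Fixpoint maxideal_pow (t : nat) : set A :=
  if t is t'.+1 then ideal_mul nonunits (maxideal_pow t') else setT.

Definition annihilator J : set A := [set x | forall y, J y -> x * y = 0].

Definition socle_degree (s : nat) : Prop :=
  ~ (maxideal_pow s `<=` [set 0]) /\
  (forall j, (s < j)%N -> maxideal_pow j `<=` [set 0]).

Definition ideal_span (fs : seq A) : set A :=
  [set x | exists c : 'I_(size fs) -> A, x = \sum_i c i * fs`_i].

Definition regular_sequence (fs : seq A) : Prop :=
  (forall i a, (i < size fs)%N ->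
     ideal_span (take i fs) (a * fs`_i) -> ideal_span (take i fs) a) /\
  ~ ideal_span fs 1.

End CommutativeRing.

Arguments artinian : clear implicits.
Arguments nonunits : clear implicits.
Arguments local_ring : clear implicits.
Arguments maxideal_pow : clear implicits.
Arguments socle_degree : clear implicits.

Section LocalAlgebra.
Variables (K : fieldType) (A : comAlgType K).
Local Notation "'m^' t" := (maxideal_pow A t) (at level 30, t at level 8).

(* dim_K (U / W) = d, for K-subspaces W `<=` U of A: there are d elements of  *)
(* U whose classes form a basis of U / W.                                     *)
Definition quotient_dim (U W : set A) (d : nat) : Prop :=
  exists e : 'I_d -> A, (forall i, U (e i)) /\
    forall x, U x -> exists! c : 'rV[K]_d, W (x - \sum_i c 0 i *: e i).

(* Artinian local with a one-dimensional socle (0 : m); the dimension is over *)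
(* K, which is the residue field of the algebras considered here.             *)
Definition artinian_gorenstein : Prop :=
  [/\ artinian A, local_ring A &
      quotient_dim (annihilator (nonunits A)) [set 0] 1].

Definition hilbert_function (h : nat -> nat) : Prop :=
  forall t, quotient_dim (m^ t) (m^ t.+1) (h t).

(* For A of socle degree s, the preimage in m^i of the subspace C(a)_i of     *)
(* m^i / m^(i+1), i.e. ((0 : m^(s+1-a-i)) :&: m^i) + m^(i+1). The natural     *)
(* subtraction implements the convention m^j = A for j <= 0.                  *)
Definition C_lift (s a i : nat) : set A :=
  [set x | exists2 y, (annihilator (m^ (s.+1 - a - i)) `&` m^ i) y &
                      (m^ i.+1) (x - y)].

(* D a is the Hilbert function of Q(a) = C(a) / C(a+1) for 0 <= a <= s - 2;   *)
(* the values of D outside this range are irrelevant.                         *)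
Definition symmetric_decomposition (D : nat -> nat -> nat) : Prop :=
  exists2 s, socle_degree A s &
    forall a i, (a.+2 <= s)%N ->
      quotient_dim (C_lift s a i) (C_lift s a.+1 i) (D a i).

End LocalAlgebra.

Arguments artinian_gorenstein {K} A.
Arguments hilbert_function {K} A h.
Arguments symmetric_decomposition {K} A D.

Section Ideals.
Variables (n : nat) (K : fieldType).
Implicit Type I : idealr {powerseries K[n]}.

Definition gorenstein_ideal I : Prop := artinian_gorenstein {ideal_quot I}.

Definition complete_intersection_ideal I : Prop :=
  artinian {ideal_quot I} /\
  exists fs : seq {powerseries K[n]},
    regular_sequence fs /\ (forall f, f \in I <-> ideal_span fs f).

End Ideals.

Local Close Scope ring_scope.
Local Open Scope nat_scope.

(* Macaulay's c^<d>: if c = 'C(k_d, d) + ... + 'C(k_j, j) is the d-th         *)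
(* Macaulay expansion of c, with k_d > ... > k_j >= j >= 1, then c^<d> is     *)
(* 'C(k_d + 1, d + 1) + ... + 'C(k_j + 1, j + 1). The expansion is greedy:    *)
(* k_d is the largest k with 'C(k, d) <= c, and k_d < c + d.                  *)
Fixpoint macaulay_bound (d c : nat) : nat :=
  match d, c with
  | 0, _ | _, 0 => 0
  | d'.+1, _ =>
      let k := \max_(k < c + d | 'C(k, d) <= c) k in
      'C(k.+1, d.+1) + macaulay_bound d' (c - 'C(k, d))
  end.

Definition O_sequence (h : nat -> nat) : Prop :=
  h 0 = 1 /\ forall t, 1 <= t -> h t.+1 <= macaulay_bound t (h t).

Definition Delta (s : nat) (h : nat -> nat) : nat :=
  \max_(3 <= i < s.+1) `|h i - h i.-1|%N.

Definition h_seq (u v w : nat) : seq nat :=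
  [:: 1; 3; 3] ++ nseq u 3 ++ nseq v 2 ++ nseq w 1 ++ [:: 1].

Definition h_vec (u v w : nat) : nat -> nat := nth 0 (h_seq u v w).

Definition delta (i : nat) : nat := i == 1.

Definition ones (l r i : nat) : nat := l <= i <= r.

(* The vectors D(0), D(w), D(w+v); those with the same index are added up.    *)
Definition D1 (u v w : nat) (a i : nat) : nat :=
  (a == 0) * ones 0 (u + v + w + 3) i
  + (a == w) * ones 1 (u + v + 2) i
  + (a == w + v) * ones 1 (u + 2) i.

Definition D2 (s : nat) (D : nat -> nat -> nat) (a i : nat) : nat :=
  D a i + (a == s - 2) * delta i.

(* D is the symmetric decomposition common to all the Artinian Gorenstein     *)
(* quotients of K[[x,y]] with Hilbert function h, and there is such a quotient. *)
Definition unique_symmetric_decomposition2 (K : fieldType) (h : nat -> nat)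
    (D : nat -> nat -> nat) : Prop :=
  (exists J : idealr {powerseries K[2]},
     gorenstein_ideal J /\ hilbert_function {ideal_quot J} h) /\
  (forall J : idealr {powerseries K[2]},
     gorenstein_ideal J -> hilbert_function {ideal_quot J} h ->
     symmetric_decomposition {ideal_quot J} D).

(* Main.v *)
Require Import Defs.
From HB Require Import structures.
From mathcomp Require Import all_boot all_order all_algebra ring_quotient.
From mathcomp Require Import falgebra mpoly boolp classical_sets zify.

(** Let A = R/I be Gorenstein with Hilbert function h and maximal ideal m, and
    let H_b = D(0) + ... + D(b), the Hilbert function of the graded algebra
    G/C(b+1). Three facts determine the vectors D(a) almost completely.

    - Symmetry, D(a)_i = D(a)_(s-a-i). The socle is a line, so a linear form
      phi which is not zero on it makes (x, y) |-> phi(xy) a perfect pairing on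
      A for which m^j and (0 : m^j) are orthogonal; symmetry is then a count of
      dimensions (sdec_sym).
    - Growth: if H_b(i) <= c with c <= i and c <= 2, then H_b(i+1) <= c. This
      is the part of the theorem of Macaulay that matters here, and it has a
      short direct proof (growth1, growth2).
    - D(a) vanishes in degrees >= s - a when a > 0, so that H_b = h in degrees
      >= s - b - 1.

    Together they give H_b = 1 for b < w and then, if v > 0, H_b = 2 in the
    degrees 1, ..., u + v + 2 for w <= b < w + v, except that at b = w + v - 1
    the value in degree 2 may jump to 3. No jump leads to D1. With a jump, H_b
    agrees with h except in degree 1, and the missing unit in degree 1 can only
    come from D(s-2); this is D2 (sdec_cases). If v = 0, which is the case
    Delta = 2, then H_w = h at once, and the decomposition is D1.

    In the second case D(s-2)_1 = 1, and A is a connected sum: m is generated by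
    x, y, z with xz = yz = 0, z m^2 = 0 and z^2 a generator of the socle
    (connected_sum). This has two consequences.

    - I is not a complete intersection. Lift x, y, z to X, Y, Z, and suppose
      that I is generated by a regular sequence f. Writing XZ and YZ, which lie
      in I, as combinations of f with coefficients al and be, the relation
      Y(XZ) = X(YZ) is a syzygy of f, hence Y al_i - X be_i lies in I, which has
      order at least 2. So al_i is not a unit, and XZ has order at least 3,
      which is absurd (killed_linear_form_not_ci).
    - The subalgebra generated by x and y is a Gorenstein quotient of K[[x, y]]
      with Hilbert function h - delta (connected_sum_summand). The numerical
      argument applied to h - delta leaves only one decomposition
      (codim2_decomposition), and it is the one from which D2 is made. *)

Set Implicit Arguments.
Unset Strict Implicit.
Unset Printing Implicit Defensive.

Import GRing.Theory.
Local Open Scope ring_scope.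

(** * Dimensions of subquotients *)

(** Products of subspaces and commutativity are both needed below. *)
#[short(type="comFalgType")]
HB.structure Definition ComFalgebra (K : fieldType) :=
  { A of Falgebra K A & GRing.ComAlgebra K A }.

Section QuotientDim.
Variables (K : fieldType) (A : comFalgType K).
Implicit Types (U W : {vspace A}) (S : set A).

Definition vset U : set A := [set x | x \in U]%classic.

(** A subspace of maximal dimension contained in S is all of S. *)
Lemma vspace_of_set S :
  S 0 -> (forall (a : K) x y, S x -> S y -> S (a *: x + y)) ->
  exists U, S = vset U.
Proof.
move=> S0 Slin.
pose P n := `[< exists U, \dim U = n /\ forall x, x \in U -> S x >].
have exP : exists n, P n.
  by exists 0%N; apply/asboolP; exists 0%VS; rewrite dimv0; split=> // x;
    rewrite memv0 => /eqP->.
have ubP n : P n -> (n <= \dim {:A})%N.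
  by case/asboolP=> U [<- _]; apply/dimvS/subvf.
case: (ex_maxnP exP ubP) => n /asboolP[U [dU US]] maxn.
exists U; apply/seteqP; split=> x /=; last exact: US.
move=> Sx; have: (\dim (U + <[x]>) <= \dim U)%N.
  rewrite dU; apply: maxn; apply/asboolP; exists (U + <[x]>)%VS; split=> // y.
  case/memv_addP=> y1 Uy1 [y2 /vlineP[a ->] ->].
  by rewrite addrC; apply: Slin => //; apply: US.
have leU := addvSl U <[x]>%VS.
move=> led; have /eqP eqU : (U == U + <[x]>)%VS by rewrite eqEdim leU led.
by rewrite /vset /= eqU; apply: subvP (addvSr U _) _ (memv_line x).
Qed.

(** The matrices expressing two bases of the quotient in terms of each other
    are inverse to each other. *)
Lemma quotient_dim_uniq U S d1 d2 :
  quotient_dim S (vset U) d1 -> quotient_dim S (vset U) d2 -> d1 = d2.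
Proof.
have half e1 e2 : quotient_dim S (vset U) e1 -> quotient_dim S (vset U) e2
  -> (e1 <= e2)%N.
  case=> e [Se He] [f [Sf Hf]].
  have /choice[P HP] i : exists c : 'rV[K]_e2, e i - \sum_j c 0 j *: f j \in U.
    by have [c [cU _]] := Hf _ (Se i); exists c.
  have /choice[Q HQ] j : exists c : 'rV[K]_e1, f j - \sum_i c 0 i *: e i \in U.
    by have [c [cU _]] := He _ (Sf j); exists c.
  pose MP := \matrix_(i, j) P i 0 j; pose MQ := \matrix_(j, i) Q j 0 i.
  apply: (@mulmx1_min K e1 e2 MP MQ).
  apply/row_matrixP => i.
  have [c [_ c_uniq]] := He _ (Se i).
  rewrite rowE mulmxA -rowE row1.
  transitivity c; last first.
    apply: c_uniq; rewrite /vset /= (bigD1 i) //= big1 ?mxE ?eqxx ?scale1r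
      ?addr0 ?subrr ?mem0v //.
    by move=> j /negPf neq_ji; rewrite mxE eqxx neq_ji scale0r.
  apply/esym/c_uniq; rewrite /vset /=.
  have -> : e i - \sum_k (row i MP *m MQ) 0 k *: e k =
     (e i - \sum_j P i 0 j *: f j) + \sum_j P i 0 j *: (f j -
       \sum_k Q j 0 k *: e k).
    rewrite -[RHS]addrA; congr (_ + _).
    under [X in _ = _ + X]eq_bigr do rewrite scalerBr scaler_sumr.
    rewrite sumrB addrA addNr add0r; congr (- _); rewrite exchange_big /=.
    apply: eq_bigr => k _; rewrite mxE scaler_suml; apply: eq_bigr => j _.
    by rewrite !mxE scalerA.
  by rewrite memvD // memv_suml // => j _; rewrite memvZ.
by move=> q1 q2; apply/eqP; rewrite eqn_leq !half.
Qed.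

Lemma quotient_dim_dim U W d : (W <= U)%VS -> (\dim W + d)%N = \dim U ->
  quotient_dim (vset U) (vset W) d.
Proof.
move=> leWU dimU.
have dimY : \dim (U :\: W) = d.
  by have := dimv_cap_compl U W; rewrite (capv_idPr leWU) -dimU => /addnI.
rewrite -dimY; set Y := (U :\: W)%VS.
have YU : (Y <= U)%VS := diffvSl U W.
exists (fun i => (vbasis Y)`_i); split=> [i|x Ux].
  by apply: (subvP YU); apply: vbasis_mem; rewrite mem_nth ?size_tuple.
have: x \in (Y + W)%VS by rewrite addv_diff (addv_idPl leWU).
case/memv_addP=> y Yy [w Ww ->].
exists (\row_i coord (vbasis Y) i y); split.
  rewrite /vset /=; under eq_bigr do rewrite mxE.
  by rewrite -coord_vbasis // addrAC subrr add0r.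
move=> c; rewrite /vset /= => cW.
have yY : y - \sum_i c 0 i *: (vbasis Y)`_i \in Y.
  rewrite memvB // memv_suml // => i _; rewrite memvZ // vbasis_mem //.
  by rewrite mem_nth ?size_tuple.
have: y - \sum_i c 0 i *: (vbasis Y)`_i \in (Y :&: W)%VS.
  rewrite memv_cap yY /=.
  by move: cW; rewrite addrAC => /memvB/(_ Ww); rewrite addrK.
rewrite capv_diff memv0 subr_eq0 => /eqP ->.
apply/rowP=> i; rewrite mxE coord_sum_free //.
by apply: basis_free (vbasisP Y).
Qed.

Lemma quotient_dimP U W d : (W <= U)%VS ->
  quotient_dim (vset U) (vset W) d <-> (\dim W + d)%N = \dim U.
Proof.
move=> leWU; split; last exact: quotient_dim_dim.
have eqU : (\dim W + (\dim U - \dim W))%N = \dim U by rewrite subnKC ?dimvS.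
by move=> qd; rewrite -[RHS]eqU; congr addn;
  apply: quotient_dim_uniq qd (quotient_dim_dim leWU eqU).
Qed.

End QuotientDim.

(** * Artinian local algebras with a finite Hilbert function *)
Section ArtinianLocal.
Variable A : comNzRingType.
Hypothesis (artA : artinian A) (locA : local_ring A).
Local Notation m := (nonunits A).
Local Notation mpow := (maxideal_pow A).

Lemma is_ideal_ideal_mul (J L : set A) : is_ideal L -> is_ideal (ideal_mul J L).
Proof.
case=> L0 LD LM; split.
- by exists [::]; rewrite big_nil; split.
- move=> _ _ [s1 [s1JL ->]] [s2 [s2JL ->]]; exists (s1 ++ s2); rewrite big_cat;
    split=> // p.
  by rewrite mem_cat => /orP[/s1JL|/s2JL].
- move=> a _ [s [sJL ->]]; exists [seq (p.1, a * p.2) | p <- s]; split.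
    by move=> _ /mapP[p /sJL[Jp Lp] ->]; split=> //=; apply: LM.
  by rewrite big_map mulr_sumr; apply: eq_bigr => p _; rewrite mulrCA.
Qed.

Lemma is_ideal_maxideal_pow t : is_ideal (mpow t).
Proof. by case: t => [|t]; [split | apply: is_ideal_ideal_mul;
  elim: t => [|t IHt]; [split|exact: is_ideal_ideal_mul]]. Qed.

Lemma maxideal_powS t x : mpow t.+1 x -> mpow t x.
Proof.
have [I0 ID IM] := is_ideal_maxideal_pow t.
case=> s [sP ->]; rewrite big_seq; elim/big_ind: _ => // p /sP[_ p2].
exact: IM.
Qed.

Lemma nonunitN1 : ~ m 1.
Proof. by apply; exists 1; rewrite mulr1. Qed.

(** Otherwise one builds x_0 = 1, x_1, x_2, ... with x_(k+1) in x_k m and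
    x_k m^N <> 0, which is possible because m^N = m m^N. The descending chain of
    the ideals (x_k) becomes stationary, so x_k is in x_k m for some k, and
    x_k = 0 because 1 + m consists of units. *)
Lemma artinian_nilpotent N :
  (forall x, mpow N x -> mpow N.+1 x) -> forall x, mpow N x -> x = 0.
Proof.
move=> mN; pose alive x := exists j, mpow N j /\ x * j != 0.
have [m0 mD mM] := locA.
have step x : exists y, alive x -> m y /\ alive (x * y).
  have [[j [Nj xj]]|] := pselect (alive x); last by exists 0.
  have [s [sP def_j]] := mN _ Nj.
  have [[p [sp xp]]|no] := pselect (exists p, p \in s /\ x * (p.1 * p.2) != 0).
    have [mp1 Np2] := sP _ sp.
    by exists p.1 => _; split=> //; exists p.2; rewrite -mulrA.
  case/eqP: xj; rewrite def_j mulr_sumr big_seq big1 // => p sp.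
  by apply/eqP; apply: contraT => xp; case: no; exists p.
have [nxt nxtP] := choice step.
move=> z Nz; apply/eqP; apply: contraT => z0.
pose xs := fun n => iter n (fun x => x * nxt x) 1.
have alive_xs n : alive (xs n).
  elim: n => [|n IHn] /=; first by exists z; rewrite mul1r.
  by case: (nxtP _ IHn).
pose F n : set A := [set xs n * a | a in setT]%classic.
have idF n : is_ideal (F n).
  split; first by exists 0; rewrite ?mulr0.
    by move=> _ _ [a _ <-] [b _ <-]; exists (a + b); rewrite ?mulrDr.
  by move=> b _ [a _ <-]; exists (b * a); rewrite // mulrCA.
have [n eqF] : exists N, forall i, (N <= i)%N -> F i = F N.
  apply: artA => // i _ [a _ <-].
  by exists (nxt (xs i) * a); rewrite //= mulrA.
have: F n (xs n) by exists 1; rewrite ?mulr1.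
rewrite -(eqF n.+1) // => -[a _ /= xsn].
have [my _] := nxtP _ (alive_xs n); set y := nxt _ in xsn my.
have [b Hb] : exists b, (1 - y * a) * b = 1.
  apply: contrapT => ny; apply: nonunitN1.
  by rewrite -(subrK (y * a) 1); apply: mD => //; rewrite mulrC; apply: mM.
have [j [_ /eqP]] := alive_xs n; case.
have: xs n * (1 - y * a) = 0 by rewrite mulrBr mulr1 mulrA xsn subrr.
by move/(congr1 (fun t => t * b)); rewrite -mulrA Hb mulr1 mul0r => ->;
  rewrite mul0r.
Qed.

End ArtinianLocal.

Section FiniteDimension.
Variables (K : fieldType) (A : comAlgType K).

Lemma quotient_dim_trans (U W X : set A) a b :
  (forall x, W x -> U x) -> (forall x, X x -> W x) ->
  W 0 -> (forall (c : K) x y, W x -> W y -> W (c *: x + y)) ->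
  quotient_dim U W a -> quotient_dim W X b -> quotient_dim U X (a + b).
Proof.
move=> WU XW W0 Wlin [e [Ue eP]] [f [Wf fP]].
have Wsum k (c : 'rV[K]_k) (g : 'I_k -> A) : (forall i, W (g i))
  -> W (\sum_i c 0 i *: g i).
  move=> Wg; elim/big_ind: _ => // [x y Wx Wy|i _].
    by rewrite -[x]scale1r; apply: Wlin.
  by rewrite -[_ *: _]addr0; apply: Wlin.
pose g (i : 'I_(a + b)) := match split i with inl j => e j | inr k => f k end.
have sumg (c : 'rV[K]_(a + b)) :
    \sum_i c 0 i *: g i = \sum_i lsubmx c 0 i *: e i +
      \sum_i rsubmx c 0 i *: f i.
  rewrite big_split_ord /=; congr (_ + _); apply: eq_bigr => i _;
    rewrite mxE /g.
    by have := unsplitK (inl i : 'I_a + 'I_b)%type; rewrite /= => ->.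
  by have := unsplitK (inr i : 'I_a + 'I_b)%type; rewrite /= => ->.
exists g; split.
  by move=> i; rewrite /g; case: (split i) => j; [apply: Ue | apply/WU/Wf].
move=> x Ux; have [c [cW c_uniq]] := eP x Ux; have [d [dX d_uniq]] := fP _ cW.
exists (row_mx c d); split; first by rewrite sumg row_mxKl row_mxKr opprD addrA.
move=> k; rewrite sumg opprD addrA => kX.
have eq_c : c = lsubmx k.
  apply: c_uniq; rewrite -[X in W X](subrK (\sum_i rsubmx k 0 i *: f i)).
  by rewrite -[X in W (X + _)]scale1r; apply: Wlin; [apply: XW | apply: Wsum].
by rewrite -[k]hsubmxK -eq_c; congr row_mx; apply: d_uniq; rewrite eq_c.
Qed.

Lemma vector_axiom_of_quotient_dim n :
  quotient_dim (setT : set A) [set 0] n -> inhabited (Vector.axiom n A).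
Proof.
case=> e [_ eP].
have /choice[c cP] x : exists c : 'rV[K]_n, x = \sum_i c 0 i *: e i.
  have [c [/= c0 _]] := eP x I; exists c.
  by apply/eqP; rewrite -subr_eq0; apply/eqP.
have cK : cancel (fun c : 'rV[K]_n => \sum_i c 0 i *: e i) c.
  move=> d; have [d' [_ d'P]] := eP (\sum_i d 0 i *: e i) I.
  transitivity d'; last by apply: d'P; apply: subrr.
  by apply/esym/d'P; rewrite -cP; apply: subrr.
constructor; exists c; last by exists (fun c : 'rV[K]_n
  => \sum_i c 0 i *: e i) => // x; rewrite -cP.
move=> a x y; apply: (can_inj cK); rewrite /= -cP {1}(cP x) {1}(cP y).
rewrite scaler_sumr -big_split; apply: eq_bigr => i _.
by rewrite !mxE scalerA scalerDl.
Qed.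

(** The packed algebra is equal, as a commutative algebra, to the one that it
    was built from (com_falgebra_ofE); statements about an Artinian local
    algebra are proved by replacing it with its finite-dimensional copy. *)
Definition com_falgebra_of n (ax : Vector.axiom n A) : comFalgType K :=
  let V : vectType K :=
    HB.pack (GRing.ComAlgebra.sort A) (Lmodule_hasFinDim.Build K A ax) in
  HB.pack (GRing.ComAlgebra.sort A) V (Algebra_isFalgebra.Build K V).

End FiniteDimension.

Lemma com_falgebra_ofE (K : fieldType) (A : comAlgType K) n (ax : Vector.axiom
  n A) :
  com_falgebra_of ax = A :> comAlgType K.
Proof. by case: A ax. Qed.

Lemma artinian_com_falgebra (K : fieldType) (A : comAlgType K) h s :
  artinian A -> local_ring A -> hilbert_function A h ->
  (forall t, (s < t)%N -> h t = 0%N) ->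
  exists B : comFalgType K, B = A :> comAlgType K.
Proof.
move=> artA locA HF h0.
have ms0 x : maxideal_pow A s.+1 x -> x = 0.
  apply: artinian_nilpotent => // y my.
  have := HF s.+1; rewrite h0 // => -[e [_ /(_ y my)[c [+ _]]]].
  by rewrite big_ord0 subr0.
have lin t (c : K) x y : maxideal_pow A t x -> maxideal_pow A t y
  -> maxideal_pow A t (c *: x + y).
  have [_ ID IM] := is_ideal_maxideal_pow A t.
  by move=> tx ty; apply: ID => //; rewrite -mulr_algl; apply: IM.
have [n qd] : exists n, quotient_dim (setT : set A) (maxideal_pow A s.+1) n.
  elim: (s.+1) => [|t [n IHt]].
    exists 0%N; exists (fun=> 0); split=> // x _; exists 0; split=> // c _.
    by apply/rowP => -[].
  exists (n + h t)%N; apply: quotient_dim_trans IHt (HF t) => //.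
  - by move=> x; apply: maxideal_powS.
  - by case: (is_ideal_maxideal_pow A t).
  - exact: lin.
have eq0 : maxideal_pow A s.+1 = [set 0]%classic.
  apply/seteqP; split=> x /=; first exact: ms0.
  by move=> ->; case: (is_ideal_maxideal_pow A s.+1).
move: qd; rewrite eq0 => /vector_axiom_of_quotient_dim[ax].
by exists (com_falgebra_of ax); rewrite com_falgebra_ofE.
Qed.

(** * Growth of the Hilbert function of a graded quotient *)
Section IdealPowers.
Variables (K : fieldType) (A : comFalgType K) (m : {vspace A}).
Hypothesis m_ideal : forall a x, x \in m -> a * x \in m.
Implicit Types (U V W : {vspace A}) (x y : A).

(** A linear property of the elements of a product of subspaces need only be
    checked on products, because it defines a subspace. *)
Lemma prodv_ind U V (P : A -> Prop) :
  P 0 -> (forall (a : K) x y, P x -> P y -> P (a *: x + y)) ->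
  (forall u v, u \in U -> v \in V -> P (u * v)) ->
  forall x, x \in (U * V)%VS -> P x.
Proof.
move=> P0 Plin PUV x xUV; have [W PW] := @vspace_of_set K A P P0 Plin.
have: x \in W; last by rewrite -[is_true _]/(vset W x) -PW.
apply: subvP xUV => //; apply/prodvP=> u v Uu Vv.
by rewrite -[is_true _]/(vset W _) -PW; apply: PUV.
Qed.

Lemma memv_sub U V x : (U <= V)%VS -> x \in U -> x \in V.
Proof. by move/subvP; apply. Qed.

(** For t = 0 this is the whole algebra, whereas the power of a subspace would
    be the line of constants. *)
Fixpoint mpow t : {vspace A} := if t is t'.+1 then (m * mpow t')%VS else fullv.

Lemma mpow_ideal t a x : x \in mpow t -> a * x \in mpow t.
Proof.
case: t x => [|t] x; first by rewrite !memvf.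
move: x; apply: prodv_ind => [|c x y Px Py|u v mu tv].
- by rewrite mulr0 mem0v.
- by rewrite mulrDr -scalerAr memvD ?memvZ.
- by rewrite mulrA memv_mul ?m_ideal.
Qed.

Lemma mpow1 : mpow 1 = m.
Proof.
apply/eqP; rewrite eqEsubv; apply/andP; split.
  by apply/prodvP => u v mu _; rewrite mulrC m_ideal.
by apply/subvP=> x mx; rewrite -[x]mulr1 memv_mul ?memvf.
Qed.

Lemma mpowS t : (mpow t.+1 <= mpow t)%VS.
Proof. by apply/prodvP=> u v _; apply: mpow_ideal. Qed.

Lemma mpow_le i j : (i <= j)%N -> (mpow j <= mpow i)%VS.
Proof.
move=> leij; rewrite -(subnK leij); elim: (j - i)%N => // k IHk.
by rewrite addSn; apply: subv_trans (mpowS _) IHk.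
Qed.

Lemma mpowM i j x y : x \in mpow i -> y \in mpow j -> x * y \in mpow (i + j).
Proof.
elim: i x => [|i IHi] x xi yj; first by rewrite add0n mpow_ideal.
move: x xi; apply: prodv_ind => [|c x z Px Pz|u v mu vi].
- by rewrite mul0r mem0v.
- by rewrite mulrDl -scalerAl memvD ?memvZ.
- by rewrite -mulrA memv_mul ?IHi.
Qed.

Lemma dimv_add_line U x : (\dim (U + <[x]>) <= \dim U + 1)%N.
Proof.
apply: leq_trans (_ : _ <= \dim U + \dim <[x]>)%N _.
  by rewrite -dimv_sum_cap leq_addr.
by rewrite leq_add2l dim_vline leq_b1.
Qed.

Lemma dimv_add_line_notin U x : x \notin U -> \dim (U + <[x]>) = (\dim U + 1)%N.
Proof.
move=> xU; have x0 : x != 0 by apply: contraNneq xU => ->; apply: mem0v.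
rewrite dimv_disjoint_sum ?dim_vline ?x0 //.
apply/eqP; rewrite -subv0; apply/subvP=> y /memv_capP[yU /vlineP[c def_y]].
rewrite memv0 def_y scaler_eq0; apply/orP; left; apply: contraNT xU => c0.
by rewrite -[x]scale1r -(mulVf c0) -scalerA -def_y memvZ.
Qed.

Lemma sub_add_line U V x : (U <= V)%VS -> (\dim V <= \dim U + 1)%N ->
  x \in V -> x \notin U -> (V <= U + <[x]>)%VS.
Proof.
move=> UV dV xV xU; have le : (U + <[x]> <= V)%VS by rewrite subv_add UV -memvE.
suff /eqP -> : (U + <[x]> == V)%VS by [].
by rewrite eqEdim le dimv_add_line_notin.
Qed.

Lemma mul_add_line U U' x e y :
  (forall u, u \in U -> x * u \in U') -> y \in (U + <[e]>)%VS ->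
  x * y \in (U' + <[x * e]>)%VS.
Proof.
move=> UU' /memv_addP[u Uu [_ /vlineP[c ->] ->]].
by rewrite mulrDr -scalerAr memv_add ?UU' ?memvZ ?memv_line.
Qed.

(** Below, L i plays the role of the preimage in m^i of the degree i part of a
    homogeneous ideal of the associated graded algebra, so that
    dim m^i - dim (L i) is the Hilbert function of a standard graded algebra. *)
Section Growth.
Variable L : nat -> {vspace A}.
Hypothesis L_le : forall i, (L i <= mpow i)%VS.
Hypothesis LM : forall i x y, x \in m -> y \in L i -> x * y \in L i.+1.

Lemma growth0 i : (mpow i <= L i)%VS -> (mpow i.+1 <= L i.+1)%VS.
Proof. by move=> le; apply/prodvP=> u v mu /(subvP le); apply: LM. Qed.

(** If the product l g spans m^i modulo L i, then for every form t we have
    t (l g) = l (t g), a multiple of l (l g) modulo L (i+1): so l (l g) spans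
    m^(i+1) modulo L (i+1). *)
Lemma growth1 i : (0 < i)%N -> (\dim (mpow i) <= \dim (L i) + 1)%N ->
  (\dim (mpow i.+1) <= \dim (L i.+1) + 1)%N.
Proof.
move=> i0 di; have [/growth0/dimvS le|nle] := boolP (mpow i <= L i)%VS.
  by rewrite (leq_trans le) ?leq_addr.
case: i i0 di nle => // i _ di nle.
have [l [g [ml gi lg]]] : exists l g, [/\ l \in m, g \in mpow i & l * g \notin
  L i.+1].
  apply: contrapT => no; case/negP: nle; apply/prodvP=> l g ml gi.
  by apply: contraT => lg; case: no; exists l, g.
have full : (mpow i.+1 <= L i.+1 + <[l * g]>)%VS.
  by apply: sub_add_line; rewrite ?memv_mul.
apply: leq_trans (dimv_add_line (L i.+2) (l * (l * g))).
apply/dimvS/prodvP=> x y mx /(subvP full)/memv_addP[u Lu [_ /vlineP[c ->] ->]].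
rewrite mulrDr memvD //; first by apply: (memv_sub (addvSl _ _)); apply: LM.
rewrite -scalerAr memvZ // mulrCA; apply: mul_add_line => [v|]; first exact: LM.
by apply: (memv_sub full); apply: memv_mul.
Qed.

(** Suppose first that x l g and y l g span m^i modulo L i, for a product l g of
    degree i - 1. Then x^2 l g, x y l g and y^2 l g span m^(i+1) modulo
    L (i+1), and they are dependent there: multiply by l a relation between
    x^2 g, x y g and y^2 g in the two-dimensional space m^i / L i. This uses
    i >= 2. Otherwise every such product l g satisfies dim (m l g) <= 1 modulo
    L i, and m^i is spanned modulo L i by e = x (l g) and e' = y (k f). Every
    form t then satisfies t e = x (t l g), a multiple of x e, and t e' is a
    multiple of y e'. *)
Lemma growth2 i : (1 < i)%N -> (\dim (mpow i) <= \dim (L i) + 2)%N ->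
  (\dim (mpow i.+1) <= \dim (L i.+1) + 2)%N.
Proof.
move=> i1 di; have [le1|gt1] := leqP (\dim (mpow i)) (\dim (L i) + 1).
  apply: leq_trans (growth1 (ltnW i1) le1) _; lia.
case: i i1 di gt1 => [|[|i]] // _ di gt1.
have full e f : e \in mpow i.+2 -> f \in mpow i.+2 -> e \notin L i.+2 ->
    f \notin (L i.+2 + <[e]>)%VS -> (mpow i.+2 <= L i.+2 + <[e]> + <[f]>)%VS.
  move=> ei fi eL fL; apply: sub_add_line => //.
    by rewrite subv_add L_le -memvE.
  by rewrite dimv_add_line_notin //; lia.
have mul_full e f x y : x \in m -> y \in (L i.+2 + <[e]> + <[f]>)%VS ->
    x * y \in (L i.+3 + <[x * e]> + <[x * f]>)%VS.
  move=> mx; apply: mul_add_line => u; apply: mul_add_line => v; exact: LM.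
have [[l [g [x [y [[ml gi mx my] fullxy]]]]]|noA] := pselect (exists l g x y,
    [/\ l \in m, g \in mpow i, x \in m & y \in m] /\
    (mpow i.+2 <= L i.+2 + <[x * (l * g)]> + <[y * (l * g)]>)%VS).
  pose X := x * (x * (l * g)); pose Y := x * (y * (l * g));
    pose Z := y * (y * (l * g)).
  have lgi : l * g \in mpow i.+1 by apply: memv_mul.
  have -> : (2 = 1 + 1)%N by [].
  have sub : (mpow i.+3 <= L i.+3 + <[X]> + <[Y]> + <[Z]>)%VS.
    apply/prodvP=> t u mt /(subvP fullxy)/memv_addP[v + [_ /vlineP[d ->] ->]].
    case/memv_addP=> w Lw [_ /vlineP[c ->] ->].
    have tlg : t * (l * g) \in mpow i.+2 by apply: memv_mul.
    have mX := mul_full _ _ _ _ mx (memv_sub fullxy tlg).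
    have mY := mul_full _ _ _ _ my (memv_sub fullxy tlg).
    rewrite !mulrDr -!scalerAr (mulrCA t x) (mulrCA t y) !memvD ?memvZ //.
    - by rewrite -!addvA; apply: (memv_sub (addvSl _ _)); apply: LM.
    - exact: memv_sub (addvSl _ _) mX.
    - apply: memv_sub mY; rewrite -/Z [y * (x * _)]mulrCA -/Y.
      by rewrite addvS // -addvA addvS // addvSr.
  have [|XL] := boolP (X \in L i.+3).
    move=> XL; move: sub; rewrite (addv_idPl XL) => /dimvS/leq_trans; apply.
    by apply: leq_trans (dimv_add_line _ _) _;
      rewrite addnA leq_add2r dimv_add_line.
  have [|YL] := boolP (Y \in L i.+3 + <[X]>)%VS.
    move=> YL; move: sub; rewrite (addv_idPl YL) => /dimvS/leq_trans; apply.
    by apply: leq_trans (dimv_add_line _ _) _;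
      rewrite addnA leq_add2r dimv_add_line.
  have ZL : Z \in (L i.+3 + <[X]> + <[Y]>)%VS.
    have cube u v : u \in m -> v \in m -> u * (v * g) \in mpow i.+2.
      by move=> mu mv; rewrite !memv_mul.
    have XE : X = l * (x * (x * g)) by rewrite /X; rewrite -!(mulrCA l) .
    have YE : Y = l * (x * (y * g)) by rewrite /Y; rewrite -!(mulrCA l).
    have ZE : Z = l * (y * (y * g)) by rewrite /Z; rewrite -!(mulrCA l).
    rewrite XE YE ZE; apply: mul_full => //;
      apply: (memv_sub (full _ _ _ _ _ _)); rewrite ?cube //.
      by apply: contra XL => XL; rewrite XE LM.
    apply: contra YL => YL; rewrite XE YE; apply: mul_add_line YL => u;
      exact: LM.
  move: sub; rewrite (addv_idPl ZL) => /dimvS/leq_trans; apply.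
  by apply: leq_trans (dimv_add_line _ _) _;
    rewrite addnA leq_add2r dimv_add_line.
have line x y l g : x \in m -> y \in m -> l \in m -> g \in mpow i ->
    x * (l * g) \notin L i.+2 -> y * (l * g) \in (L i.+2 + <[x * (l * g)]>)%VS.
  move=> mx my ml gi nL; apply: contraT => nL2; case: noA; exists l, g, x, y.
  by split=> //; apply: full => //; rewrite !memv_mul.
have exprod W : (mpow i.+2 <= W)%VS = false -> exists x l g,
    [/\ x \in m, l \in m, g \in mpow i & x * (l * g) \notin W].
  move/negbT=> nle; apply: contrapT => no; case/negP: nle.
  apply/prodvP=> x y mx; move: y; apply: prodv_ind => [|c y z Py Pz|l g ml gi].
  - by rewrite mulr0 mem0v.
  - by rewrite mulrDr -scalerAr memvD ?memvZ.
  - by apply: contraT => nL; case: no; exists x, l, g.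
have [|x [l [g [mx ml gi nL1]]]] := exprod (L i.+2).
  by apply: contraTF gt1 => /dimvS; lia.
have [|y [k [f [my mk fi nL2]]]] := exprod (L i.+2 + <[x * (l * g)]>)%VS.
  by apply: contraTF gt1 => /dimvS; rewrite dimv_add_line_notin //; lia.
have nL2' : y * (k * f) \notin L i.+2.
  by apply: contra nL2; apply/memv_sub/addvSl.
set e := x * (l * g) in nL1 nL2; set e' := y * (k * f) in nL2 nL2'.
have fullee : (mpow i.+2 <= L i.+2 + <[e]> + <[e']>)%VS.
  by apply: full => //; rewrite !memv_mul.
suff sub : (mpow i.+3 <= L i.+3 + <[x * e]> + <[y * e']>)%VS.
  apply: leq_trans (dimvS sub) _; apply: leq_trans (dimv_add_line _ _) _.
  by rewrite (addnA _ 1%N 1%N) leq_add2r dimv_add_line.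
apply/prodvP=> t u mt /(subvP fullee)/memv_addP[v + [_ /vlineP[d ->] ->]].
case/memv_addP=> w Lw [_ /vlineP[c ->] ->].
rewrite !mulrDr -!scalerAr !memvD ?memvZ //.
- by rewrite -!addvA; apply: (memv_sub (addvSl _ _)); apply: LM.
- apply: (memv_sub (addvSl _ _)); rewrite mulrCA; apply: mul_add_line.
    by move=> z; apply: LM.
  exact: line.
- rewrite -addvA [(<[x * e]> + _)%VS]addvC addvA;
    apply: (memv_sub (addvSl _ _)); rewrite mulrCA; apply: mul_add_line.
    by move=> z; apply: LM.
  exact: line.
Qed.

End Growth.
End IdealPowers.

(** * Annihilators and duality *)
Section Annihilators.
Variables (K : fieldType) (A : comFalgType K).
Implicit Types (U V W : {vspace A}) (x y : A).

Definition annv U : {vspace A} :=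
  (\bigcap_(i < \dim U) lker (amulr (vbasis U)`_i))%VS.

Lemma annvP U x : reflect (forall u, u \in U -> x * u = 0) (x \in annv U).
Proof.
apply: (iffP idP) => [|xU].
  move=> /subv_bigcapP xU u /coord_vbasis ->; rewrite mulr_sumr big1 // => i _.
  have := xU i isT; rewrite -memvE memv_ker lfunE /= => /eqP x0.
  by rewrite -scalerAr x0 scaler0.
apply/subv_bigcapP => i _; rewrite -memvE memv_ker lfunE /= xU //.
by rewrite vbasis_mem ?mem_nth ?size_tuple.
Qed.

Definition idealv U := forall a x, x \in U -> a * x \in U.

Lemma idealv_add U V : idealv U -> idealv V -> idealv (U + V).
Proof.
by move=> IU IV a _ /memv_addP[u Uu [v Vv ->]]; rewrite mulrDr memv_add ?IU ?IV.
Qed.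

Lemma idealv_annv U : idealv (annv U).
Proof. by move=> a x /annvP xU; apply/annvP => u /xU; rewrite -mulrA => ->;
  rewrite mulr0. Qed.

Lemma annvS U V : (U <= V)%VS -> (annv V <= annv U)%VS.
Proof. by move=> UV; apply/subvP=> x /annvP xV;
  apply/annvP => u /(subvP UV)/xV. Qed.

Lemma annv_add U V : annv (U + V) = (annv U :&: annv V)%VS.
Proof.
apply/eqP; rewrite eqEsubv subv_cap !annvS ?addvSl ?addvSr //=.
apply/subvP=> x /memv_capP[/annvP xU /annvP xV];
  apply/annvP=> _ /memv_addP[u Uu [v Vv ->]].
by rewrite mulrDr xU ?xV ?addr0.
Qed.

(** A linear form phi whose kernel contains no nonzero ideal makes
    (x, y) |-> phi (x y) a nondegenerate pairing, for which the orthogonal of an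
    ideal is its annihilator. *)
Section Duality.
Variable phi : {scalar A}.
Hypothesis phi_nondeg : forall x, x != 0 -> exists y, phi (x * y) != 0.

(** The map sending x to the vector of the phi (x u_j), for a basis (u_j) of U,
    has kernel annv U; it is onto because the matrix P of the phi (e_i u_j), for
    a basis (e_i) of A, has independent columns. *)
Lemma dimv_annv U : idealv U -> (\dim (annv U) + \dim U)%N = \dim {:A}.
Proof.
move=> IU; pose X := vbasis U; pose e := vbasis {:A}.
pose P := \matrix_(i < \dim {:A}, j < \dim U) phi (e`_i * X`_j).
have /row_fullP[B BP] : row_full P.
  rewrite /row_full -mxrank_tr -[_ == _]/(row_free P^T) -kermx_eq0;
    apply/rowV0P => c /sub_kermxP cP.
  have u0 : \sum_j c 0 j *: X`_j = 0.
    apply/eqP; apply: contraT => /phi_nondeg[y /eqP[]].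
    rewrite (coord_vbasis (memvf y)) mulr_sumr linear_sum big1 // => i _.
    rewrite -scalerAr linearZ /= mulr_suml linear_sum.
    have /rowP/(_ i) := cP; rewrite !mxE => ci0.
    rewrite (eq_bigr (fun j => c 0 j * P^T j i)) ?ci0 ?mulr0 // => j _.
    by rewrite !mxE -scalerAl linearZ /= [_ * e`__]mulrC.
  have c0 := freeP (basis_free (vbasisP U)) (fun j => c 0 j) u0.
  by apply/rowP=> j; rewrite c0 mxE.
have linR : linear (fun x => \row_(j < \dim U) phi (x * X`_j)).
  by move=> a x y; apply/rowP=> j; rewrite !mxE mulrDl -scalerAl linearP.
pose RL : {linear A -> 'rV[K]_(\dim U)} := HB.pack (fun x
  => \row_(j < \dim U) phi (x * X`_j))
  (GRing.isLinear.Build _ _ _ _ _ linR).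
pose R := linfun RL.
have kerR : lker R = annv U.
  apply/vspaceP=> x; rewrite memv_ker lfunE /=;
    apply/eqP/annvP => [/rowP Rx u Uu|xU].
    apply/eqP; apply: contraT => /phi_nondeg[y /eqP[]].
    have: u * y \in U by rewrite mulrC; apply: IU.
    move=> /coord_vbasis; rewrite -mulrA => ->;
      rewrite mulr_sumr linear_sum big1 // => j _.
    by have := Rx j; rewrite -scalerAr linearZ !mxE /= => ->; rewrite mulr0.
  apply/rowP=> j; rewrite !mxE xU ?linear0 //.
  by rewrite vbasis_mem ?mem_nth ?size_tuple.
have imR : limg R = fullv.
  apply/eqP; rewrite eqEsubv subvf; apply/subvP=> v _.
  have -> : v = R (\sum_i (v *m B) 0 i *: e`_i);
    last by rewrite memv_img ?memvf.
  rewrite lfunE /=; apply/rowP=> j; rewrite mxE mulr_suml linear_sum.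
  rewrite -[v in LHS]mulmx1 -BP mulmxA mxE; apply: eq_bigr => i _.
  by rewrite -scalerAl linearZ /= [P _ _]mxE.
have := limg_ker_dim R fullv; rewrite capfv kerR imR => <-; congr addn.
by rewrite dimvf /dim /= mul1n.
Qed.

Lemma annvK U : idealv U -> annv (annv U) = U.
Proof.
move=> IU; apply/esym/eqP; rewrite eqEdim; apply/andP; split.
  by apply/subvP=> u Uu; apply/annvP => x /annvP/(_ u Uu); rewrite mulrC.
have := dimv_annv IU; have := dimv_annv (@idealv_annv U); lia.
Qed.

(** Both intersections are annihilators of sums: U meets annv V in
    annv (annv U + V). *)
Lemma dimv_cap_annv U V : idealv U -> idealv V ->
  (\dim (U :&: annv V) + \dim V = \dim (V :&: annv U) + \dim U)%N.
Proof.
move=> IU IV; rewrite -{1}(annvK IU) -annv_add.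
have IaU := @idealv_annv U.
have := dimv_annv (idealv_add IaU IV); have := dimv_annv IU.
by have := dimv_sum_cap (annv U) V; rewrite capvC; lia.
Qed.

End Duality.
End Annihilators.

(** * The symmetric decomposition of a Gorenstein local algebra *)
Section LocalGorenstein.
Variables (K : fieldType) (A : comFalgType K) (m : {vspace A}) (s : nat).
Hypothesis m_ideal : idealv m.
Local Notation M := (mpow m).

(** The preimage in m^i of C(a)_i. *)
Definition Cspace a i : {vspace A} := (annv (M (s.+1 - a - i)) :&: M i
  + M i.+1)%VS.
(** The Hilbert function D(0) + ... + D(b) of G / C(b+1). *)
Definition hf_quot b i := (\dim (M i) - \dim (Cspace b.+1 i))%N.
Definition sdec a i := (\dim (Cspace a i) - \dim (Cspace a.+1 i))%N.

Lemma Cspace_le a i : (Cspace a i <= M i)%VS.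
Proof. by rewrite subv_add capvSr mpowS. Qed.

Lemma CspaceS a i : (Cspace a.+1 i <= Cspace a i)%VS.
Proof. by rewrite addvS ?capvS // annvS // mpow_le //; lia. Qed.

Lemma Cspace_mul b i x y : x \in m -> y \in Cspace b i
  -> x * y \in Cspace b i.+1.
Proof.
move=> xm /memv_addP[u /memv_capP[/annvP ua ui] [v vi ->]].
rewrite mulrDr memv_add //; last exact: memv_mul.
rewrite memv_cap memv_mul // andbT; apply/annvP => z zi.
rewrite mulrAC mulrC; case: (posnP (s.+1 - b - i)) => [k0|k0].
  by rewrite ua ?mulr0 // k0 memvf.
apply: ua; have -> : (s.+1 - b - i = (s.+1 - b - i.+1).+1)%N by lia.
exact: memv_mul.
Qed.

Lemma annv_full : annv {:A} = 0%VS.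
Proof.
apply/eqP; rewrite -subv0; apply/subvP=> x /annvP/(_ 1 (memvf _)).
by rewrite mulr1 => ->; apply: mem0v.
Qed.

Lemma Cspace_gt a i : (s < a + i)%N -> Cspace a i = M i.+1.
Proof.
by move=> lt; rewrite /Cspace (_ : _ - i = 0)%N /= ?annv_full ?cap0v ?add0v //;
  lia.
Qed.

Lemma sdec_gt a i : (s < a + i)%N -> sdec a i = 0%N.
Proof. by move=> lt; rewrite /sdec !Cspace_gt ?subnn //; lia. Qed.

Lemma dim_Cspace a i : (\dim (Cspace a i)
  + \dim (M i.+1 :&: annv (M (s.+1 - a - i))))%N =
  (\dim (M i :&: annv (M (s.+1 - a - i))) + \dim (M i.+1))%N.
Proof.
rewrite [(M i :&: _)%VS]capvC -[RHS]dimv_sum_cap; congr (_ + \dim _)%N.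
by rewrite -capvA (capv_idPr (mpowS m_ideal i)) capvC.
Qed.

Lemma hf_quotS b i : hf_quot b.+1 i = (hf_quot b i + sdec b.+1 i)%N.
Proof.
have := dimvS (Cspace_le b.+1 i); have := dimvS (CspaceS b.+1 i);
  rewrite /hf_quot /sdec; lia.
Qed.

Lemma hf_quot_full b i : (s <= b)%N -> hf_quot b i
  = (\dim (M i) - \dim (M i.+1))%N.
Proof. by move=> lesb; rewrite /hf_quot Cspace_gt //; lia. Qed.

Lemma hf_quot_growth b i c : (c <= i)%N -> (c <= 2)%N ->
  (hf_quot b i <= c)%N -> (hf_quot b i.+1 <= c)%N.
Proof.
have Lle := Cspace_le b.+1; have LM := @Cspace_mul b.+1.
rewrite /hf_quot; case: c => [|[|[|//]]] ci _ H.
- have := dimvS (growth0 LM (i := i) _).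
  have le : (\dim (M i) <= \dim (Cspace b.+1 i))%N by lia.
  suff full : (M i <= Cspace b.+1 i)%VS by move=> /(_ full); lia.
  by have := eqEdim (Cspace b.+1 i) (M i); rewrite Lle le => /eqP ->.
- by have := growth1 Lle LM ci; lia.
- by have := growth2 Lle LM ci; lia.
Qed.

Hypothesis mP : nonunits A = vset m.
Hypothesis dim_res : (\dim m + 1)%N = \dim {:A}.
Hypothesis mpow_s1 : mpow m s.+1 = 0%VS.
Hypothesis mpow_s : mpow m s != 0%VS.
Hypothesis dim_soc : \dim (annv m) = 1%N.

Lemma unit_notin_m x : x \notin m -> exists y, x * y = 1.
Proof.
move=> xm; apply: contrapT => nx; case/negP: xm.
by rewrite -[is_true _]/(vset m x) -mP.
Qed.

Lemma m_notunit x y : x \in m -> x * y <> 1.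
Proof.
by rewrite -[is_true _]/(vset m x) -mP => nx xy; apply: nx; exists y.
Qed.

Lemma mpow_gt j : (s < j)%N -> M j = 0%VS.
Proof. by move=> ltsj; apply/eqP; rewrite -subv0 -mpow_s1; apply: mpow_le. Qed.

Lemma annv_sub_m j : (j <= s)%N -> (annv (M j) <= m)%VS.
Proof.
move=> lejs; apply/subvP=> x /annvP xM; apply: contraT => /unit_notin_m[y xy].
case/negP: mpow_s; rewrite -subv0; apply: subv_trans (mpow_le m_ideal lejs) _.
apply/subvP=> z /xM xz; rewrite memv0; apply/eqP.
by rewrite -[z]mul1r -xy mulrAC xz mul0r.
Qed.

(** The socle is a line that contains the nonzero space m^s. *)
Lemma socle_eq : annv m = M s.
Proof.
apply/esym/eqP; rewrite eqEdim dim_soc; apply/andP; split; last first.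
  by rewrite lt0n dimv_eq0.
apply/subvP=> x xs; apply/annvP=> y ym; apply/eqP;
  rewrite -memv0 -mpow_s1 mulrC.
exact: memv_mul.
Qed.

(** For x <> 0, let k be the last exponent with x m^k <> 0; then x m^k is a
    nonzero part of the socle. So phi need only be nonzero on the socle. *)
Lemma dualizing_form : exists phi : {scalar A},
  forall x, x != 0 -> exists y, phi (x * y) != 0.
Proof.
pose c := vbasis (annv m).
have c0 : (0 < \dim (annv m))%N by rewrite dim_soc.
pose i0 : 'I_(\dim (annv m)) := Ordinal c0.
have lin : linear (fun x => coord c i0 (projv (annv m) x) : K^o).
  by move=> a x y; rewrite !linearP.
pose phi : {scalar A} := HB.pack (fun x => coord c i0 (projv (annv m) x) : K)
   (GRing.isLinear.Build K A K *%R (fun x => coord c i0 (projv (annv m) x) : K)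
     lin).
exists phi => x x0.
have [k [y [yk xy Hk]]] : exists k y, [/\ y \in M k, x * y != 0 & forall z, z
  \in M k.+1 -> x * z = 0].
  apply: contrapT => no.
  have all k : exists2 y, y \in M k & x * y != 0.
    elim: k => [|k [y yk xy]]; first by exists 1; rewrite ?memvf ?mulr1.
    apply: contrapT => no2; apply: no; exists k, y; split=> // z zk.
    by apply/eqP; apply: contraT => xz; case: no2; exists z.
  by have [y] := all s.+1; rewrite mpow_s1 memv0 => /eqP ->; rewrite mulr0 eqxx.
exists y; rewrite /phi /=.
have sxy : x * y \in annv m.
  by apply/annvP=> u um; rewrite -mulrA [y * u]mulrC; apply: Hk;
    apply: memv_mul.
rewrite projv_id //; apply: contraNneq xy => c00.
rewrite (coord_vbasis sxy) big1 // => i _.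
suff -> : i = i0 by rewrite c00 scale0r.
by apply/val_inj => /=; have := ltn_ord i;
  rewrite {2}dim_soc ltnS leqn0 => /eqP.
Qed.

Lemma Cspace0 i : Cspace 0 i = M i.
Proof.
have [lt|le] := ltnP s i; first by rewrite Cspace_gt // !mpow_gt // ltnW.
rewrite /Cspace (capv_idPr _); first by apply/addv_idPl/mpowS.
apply/subvP=> x xi; apply/annvP => y yi; apply/eqP.
rewrite -memv0 -mpow_s1; have -> : s.+1 = (i + (s.+1 - 0 - i))%N by lia.
exact: mpowM.
Qed.

(** With j = s - a - i and d(k, l) = dim (m^k :&: (0 : m^l)), the number
    sdec a i is the mixed second difference
    d(i, j+1) - d(i+1, j+1) - d(i, j) + d(i+1, j). By duality d(k, l) - d(l, k)
    is dim m^k - dim m^l, whose mixed second difference vanishes. *)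
Lemma sdec_sym a i : (a + i <= s)%N -> sdec a i = sdec a (s - a - i).
Proof.
move=> le; have [phi phi_nd] := dualizing_form; set j := (s - a - i)%N.
have idM k : idealv (M k) by move=> ? ?; apply: mpow_ideal.
have sym k l := dimv_cap_annv phi_nd (idM k) (idM l).
have := dim_Cspace a i; have := dim_Cspace a.+1 i; have := dim_Cspace a j;
  have := dim_Cspace a.+1 j.
have -> : (s.+1 - a - i = j.+1)%N by lia.
have -> : (s.+1 - a.+1 - i = j)%N by lia.
have -> : (s.+1 - a - j = i.+1)%N by lia.
have -> : (s.+1 - a.+1 - j = i)%N by lia.
have := sym i j; have := sym i.+1 j; have := sym i j.+1; have := sym i.+1 j.+1.
have := dimvS (CspaceS a i); have := dimvS (CspaceS a j).
rewrite /sdec; lia.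
Qed.

Lemma Cspace_a0 a : (0 < a)%N -> Cspace a 0 = m.
Proof.
move=> a0; rewrite /Cspace mpow1 // capvf; apply/addv_idPr/annv_sub_m; lia.
Qed.

Lemma sdec00 : sdec 0 0 = 1%N.
Proof. by rewrite /sdec Cspace0 Cspace_a0 //= -dim_res; lia. Qed.

Lemma sdec_a0 a : (0 < a)%N -> sdec a 0 = 0%N.
Proof. by move=> a0; rewrite /sdec !Cspace_a0 ?subnn. Qed.

Lemma hf_quot0 i : hf_quot 0 i = sdec 0 i.
Proof. by rewrite /hf_quot /sdec Cspace0. Qed.

End LocalGorenstein.

(** * The numerical possibilities for a symmetric decomposition *)
Section Numerics.
Local Open Scope nat_scope.
Variables (u v w e : nat).
Let s := u + v + w + 3.

(** The parameter e is 1 for the Hilbert function h of the algebra, and 0 for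
    h - delta, so that both are treated at the same time. *)
Definition h_par (i : nat) : nat :=
  if i == 0 then 1 else if i == 1 then 2 + e else if i <= u + 2 then 3
  else if i <= u + v + 2 then 2 else if i <= s then 1 else 0.

Local Ltac h_par_tac := rewrite /h_par /s; repeat (case: ifP => ?); lia.

Lemma h_par_1 : h_par 1 = 2 + e.
Proof. by []. Qed.
Lemma h_par_3 i : 1 < i -> i <= u + 2 -> h_par i = 3.
Proof. h_par_tac. Qed.
Lemma h_par_2 i : u + 2 < i -> i <= u + v + 2 -> h_par i = 2.
Proof. h_par_tac. Qed.
Lemma h_par_one i : u + v + 2 < i -> i <= s -> h_par i = 1.
Proof. h_par_tac. Qed.
Lemma h_par_gt i : s < i -> h_par i = 0.
Proof. h_par_tac. Qed.

Variables (D H : nat -> nat -> nat).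
Hypothesis D_sym : forall a i, a + i <= s -> D a i = D a (s - a - i).
Hypothesis D_gt : forall a i, s < a + i -> D a i = 0.
Hypothesis D00 : D 0 0 = 1.
Hypothesis Da0 : forall a, 0 < a -> D a 0 = 0.
Hypothesis H0 : forall i, H 0 i = D 0 i.
Hypothesis HS : forall b i, H b.+1 i = H b i + D b.+1 i.
Hypothesis H_full : forall b i, s <= b -> H b i = h_par i.
Hypothesis H_growth : forall b i c, c <= i -> c <= 2 -> H b i <= c
  -> H b i.+1 <= c.

Lemma H_mono b b' i : b <= b' -> H b i <= H b' i.
Proof. by move=> /subnK <-; elim: (b' - b) => // k IHk; rewrite addSn HS;
  lia. Qed.

Lemma H_le b i : H b i <= h_par i.
Proof.
have [le|lt] := leqP s b; first by rewrite H_full.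
by rewrite -(H_full i (leqnn s)) H_mono // ltnW.
Qed.

Lemma D_end a i : 0 < a -> s <= a + i -> D a i = 0.
Proof.
move=> a0; rewrite leq_eqVlt => /orP[/eqP si|]; last exact: D_gt.
rewrite D_sym ?si //; have -> : a + i - a - i = 0 by lia.
exact: Da0.
Qed.

Lemma H_stable b b' i : b <= b' -> s <= b.+1 + i -> H b' i = H b i.
Proof.
move=> /subnK <- si; elim: (b' - b) => // k IHk.
by rewrite addSn HS IHk D_end ?addn0 //; lia.
Qed.

Lemma H_end b i : s <= b.+1 + i -> H b i = h_par i.
Proof.
move=> si; have [le|lt] := leqP s b; first by rewrite H_full.
by rewrite -(H_full i (leqnn s)) (H_stable (b := b)) // ltnW.
Qed.

(** The contrapositive of growth: a large value in a high degree forces large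
    values in all lower degrees down to c. *)
Lemma H_ge b i j c : c <= i -> c <= 2 -> i <= j -> c < H b j -> c < H b i.
Proof.
move=> ci c2 /subnK <-; rewrite !ltnNge; apply: contra => Hi.
by elim: (j - i) => // k IHk; rewrite addSn H_growth //; lia.
Qed.

Lemma H_ub b i j c : c <= i -> c <= 2 -> i <= j -> H b i <= c -> H b j <= c.
Proof. by move=> ci c2 ij; rewrite leqNgt => Hi; rewrite leqNgt;
  apply: contra Hi; apply: H_ge. Qed.

Lemma D_H a i : 0 < a -> H a i = H a.-1 i + D a i.
Proof. by case: a => // a _; rewrite HS. Qed.

(** By symmetry, passing from H_(a-1) to H_a adds the same amount in degrees i
    and j; in the applications i is 1 or 2, and j is so high that H_a(j) is
    known. *)
Lemma D_deg a : 0 < a -> forall i j, i + j + a = s -> H a i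
  = H a.-1 i + (H a j - H a.-1 j).
Proof.
move=> a0 i j def_s; rewrite (D_H i a0) (D_H j a0) D_sym; last by lia.
have -> : s - a - i = j by lia.
lia.
Qed.

Lemma H0_deg i j : i + j = s -> H 0 i = H 0 j.
Proof. by move=> ij; rewrite !H0 D_sym; [congr D; lia | lia]. Qed.

Lemma H_a0 b : H b 0 = 1.
Proof. by elim: b => [|b IHb]; rewrite ?H0 ?D00 // HS IHb Da0. Qed.

Lemma H_top b : H b s = 1.
Proof.
rewrite (H_stable (b := 0)) // ?(@H0_deg s 0) ?H_a0 //; lia.
Qed.

Lemma H_gt0 b i : i <= s -> 0 < H b i.
Proof. by move=> le; apply: (@H_ge b i s) => //; rewrite H_top. Qed.

Lemma H_low b : b < w -> forall i, i <= s -> H b i = 1.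
Proof.
have one b' : H b' 1 <= 1 -> forall i, i <= s -> H b' i = 1.
  move=> H1 [|i] le; first exact: H_a0.
  have := H_gt0 b' le; have := @H_ub b' 1 i.+1 1 isT isT isT H1; lia.
elim: b => [|b IHb] ltw; apply: one.
  rewrite (@H0_deg 1 s.-1); last by rewrite /s; lia.
  by apply: leq_trans (H_le _ _) _; rewrite h_par_one /s; lia.
have IH := IHb (ltnW ltw).
have := @D_deg b.+1 isT 1 (s - b.+2) _.
rewrite /= !IH; try by rewrite /s; lia.
have := H_le b.+1 (s - b.+2); rewrite h_par_one /s; try lia.
Qed.

Lemma H_pred_w i : 0 < w -> i <= s -> H w.-1 i = 1.
Proof. by move=> w0; apply: H_low; rewrite prednK. Qed.

Lemma H_w_1 : H w 1 = h_par (u + v + 2).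
Proof.
have [w0|w0] := posnP w.
  rewrite w0 (@H0_deg 1 (u + v + 2)); last by rewrite /s; lia.
  by rewrite -(@H_end 0) // /s; lia.
have := @D_deg w w0 1 (u + v + 2) _; rewrite !H_pred_w // /s; try lia.
have := @H_end w (u + v + 2); rewrite /s => -> ; last lia.
move=> ->; try lia.
have := H_gt0 w (i := u + v + 2); rewrite H_end /s; lia.
Qed.

Lemma H_eq b b' i : b <= b' -> H b i = h_par i -> H b' i = h_par i.
Proof. by move=> le eqh; have := H_mono i le; have := H_le b' i; lia. Qed.

Lemma H_threes b : H b (u + 2) = 3 -> forall i, 1 < i -> i <= u + 2 -> H b i
  = h_par i.
Proof.
move=> top i i1 iu; have := @H_ge b i (u + 2) 2 i1 isT iu;
  rewrite top => /(_ isT).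
by have := H_le b i; rewrite h_par_3 //; lia.
Qed.

Lemma H_end_w b i : w <= b -> u + v + 2 < i -> H b i = h_par i.
Proof. by move=> wb ui; apply: H_end; rewrite /s; lia. Qed.

(** Without a plateau at height 2, the three units of h(1) are reached at once
    at index w, and growth forces the full plateau at height 3. *)
Lemma H_no_two : v = 0 -> e = 1 -> forall b i, w <= b -> H b i = h_par i.
Proof.
move=> v0 e1 b i wb; apply: H_eq wb _.
have [lt|le] := ltnP (u + 2) i; first by apply: H_end_w; lia.
case: i le => [|[|i]] le; first by rewrite H_a0.
  by rewrite H_w_1 h_par_3 ?h_par_1; lia.
by apply: H_threes => //; rewrite H_end ?h_par_3 // /s; lia.
Qed.

Section PositiveV.
Hypothesis v0 : 0 < v.

Lemma H_ge2 b i : w <= b -> 0 < i -> i <= u + v + 2 -> 1 < H b i.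
Proof.
move=> wb i0 iu; apply: leq_trans (H_mono i wb).
by apply: (@H_ge w i (u + v + 2)) => //; rewrite H_end ?h_par_2 // /s; lia.
Qed.

Lemma H_one b : w <= b -> b < w + v -> H b 1 = 2.
Proof.
move=> /subnK <-; elim: (b - w) => [|k IHk] lt; first by rewrite H_w_1 h_par_2;
  lia.
rewrite addSn (@D_deg (k + w).+1 _ 1 (s - (k + w).+2)) //=; last by rewrite /s;
  lia.
rewrite IHk; last lia.
have := H_le (k + w).+1 (s - (k + w).+2); rewrite h_par_2; try by rewrite /s;
  lia.
by have := @H_ge2 (k + w) (s - (k + w).+2) _ _ _; rewrite /s; lia.
Qed.

(** The degree s - b - 2 symmetric to 2 lies on the plateau of h at height 2,
    which leaves no room in degree 2. *)
Lemma H_two b : w <= b -> b + 2 <= w + v -> H b 2 = 2.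
Proof.
move=> wb bv; apply/eqP; rewrite eqn_leq H_ge2 ?andbT //; last by lia.
move: bv; have [k ->] : exists k, b = k + w by exists (b - w); lia.
elim: k => [|k IHk] bv.
  have h2 : H w (u + v + 1) <= 2 by apply: leq_trans (H_le _ _) _;
    rewrite h_par_2; lia.
  rewrite add0n; have [w0|w0] := posnP w.
    move: h2; rewrite w0 (@H0_deg 2 (u + v + 1)) //; rewrite /s; lia.
  rewrite (@D_deg w w0 2 (u + v + 1)); last by rewrite /s; lia.
  rewrite !H_pred_w //; rewrite /s; lia.
rewrite addSn (@D_deg (k + w).+1 _ 2 (s - (k + w) - 3)) //=;
  last by rewrite /s; lia.
have := H_le (k + w).+1 (s - (k + w) - 3); rewrite h_par_2; try by rewrite /s;
  lia.
have := @H_ge2 (k + w) (s - (k + w) - 3) _ _ _; have := IHk; rewrite /s; lia.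
Qed.

Lemma H_flat b i : w <= b -> H b 2 <= 2 -> H b 1 = 2 -> 0 < i
  -> i <= u + v + 2 -> H b i = 2.
Proof.
move=> wb b2 b1 i0 iu; apply/eqP; rewrite eqn_leq H_ge2 ?andbT //.
by case: i i0 iu => [|[|i]] // _ _; [rewrite b1 | apply: (@H_ub b 2)].
Qed.

(* The index for which the degrees 2 and u + 2 are symmetric. *)
Let b0 := w + v - 1.

Lemma H_b0 : H b0 2 = H b0 (u + 2).
Proof.
have [b00|b00] := posnP b0.
  by rewrite b00; apply: H0_deg; rewrite /s; move: b00; rewrite /b0; lia.
rewrite (@D_deg b0 b00 2 (u + 2)); last by rewrite /s /b0; lia.
have -> : H b0.-1 2 = H b0.-1 (u + 2).
  have [v1|v2] : v = 1 \/ 1 < v by lia.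
    have -> : b0.-1 = w.-1 by rewrite /b0; lia.
    have w0 : 0 < w by move: b00; rewrite /b0; lia.
    by rewrite !H_pred_w // /s; lia.
  have h2 : H b0.-1 2 = 2 by apply: H_two; rewrite /b0; lia.
  have h1 : H b0.-1 1 = 2 by apply: H_one; rewrite /b0; lia.
  by rewrite h2; apply/esym/H_flat; rewrite ?h2 // /b0; lia.
by have := @H_mono b0.-1 b0 (u + 2) (leq_pred _); lia.
Qed.

(** Without a jump, D(w+v)_1 = D(w+v)_(u+2) = 1, which brings the value in
    degree 1 to 3; growth then fills the plateau at height 3. *)
Lemma H_b0_eq2 : H b0 2 = 2 -> 0 < e /\ forall i, e <= 1 -> H (w + v) i
  = h_par i.
Proof.
move=> b2.
have top : H (w + v) (u + 2) = 3 by rewrite H_end ?h_par_3 // /s; lia.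
have h1 : H (w + v) 1 = 3.
  rewrite (@D_deg (w + v) _ 1 (u + 2)); try by rewrite /s; lia.
  have -> : (w + v).-1 = b0 by rewrite /b0; lia.
  by rewrite top -H_b0 b2 H_one //; rewrite /b0; lia.
have e0 := H_le (w + v) 1; rewrite h1 h_par_1 in e0.
split=> [|i e1]; first by lia.
have [lt|le] := ltnP (u + 2) i; first by apply: H_end; rewrite /s; lia.
case: i le => [|[|i]] le; first by rewrite H_a0.
  by rewrite h1 h_par_1; lia.
by apply: H_threes.
Qed.

(** With a jump, growth fills the plateau at height 3 except in degree 1. Later
    on, the degree symmetric to 1 is already full, as long as it is not 1
    itself, which happens at index s - 2. *)
Lemma H_b0_eq3 : H b0 2 = 3 ->
  (forall b i, b0 <= b -> i != 1 -> H b i = h_par i) /\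
  (forall b, b0 <= b -> H b 1 = if b < s - 2 then 2 else 2 + e).
Proof.
move=> b3.
have stab b i : b0 <= b -> i != 1 -> H b i = h_par i.
  move=> le i1; apply: H_eq le _.
  have [lt|le] := ltnP (u + 2) i; first by apply: H_end; rewrite /s /b0; lia.
  case: i i1 le => [|[|i]] // _ le; first by rewrite H_a0.
  by apply: H_threes => //; rewrite -H_b0.
split=> // b; case: ltnP => [lt|le] bb; last by rewrite H_end ?h_par_1 // /s;
  lia.
move: bb lt => /subnK <-; elim: (b - b0) => [|k IHk] lt.
  by rewrite H_one //; rewrite /b0; lia.
rewrite addSn (@D_deg (k + b0).+1 _ 1 (s - (k + b0).+2)) //=;
  last by rewrite /s; lia.
have j1 : s - (k + b0).+2 != 1 by lia.
rewrite (stab (k + b0).+1) ?(stab (k + b0) (s - (k + b0).+2)) ?subnn ?addn0 //;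
  try by rewrite /b0; lia.
by apply: IHk; lia.
Qed.

End PositiveV.

(** Used to pass from a sum of step functions in a to its increments. *)
Lemma stepE x a : 0 < a -> (x <= a) = (x <= a.-1) + (a == x) :> nat.
Proof. by case: a => // a _ /=; rewrite leq_eqVlt ltnS [a.+1 == x]eq_sym;
  have [->|_] := eqVneq x a.+1; rewrite ?ltnn ?addn0. Qed.

(** If H_a is a sum of vectors, each added from some index on, then D(a)
    collects the vectors added at index a. *)
Lemma sdec_of_steps (p : nat -> nat) (xq : seq (nat * (nat -> nat))) :
  (forall a i, i <= s -> H a i = p i + \sum_(z <- xq) (z.1 <= a) * z.2 i) ->
  forall a i, i <= s -> D a i = (a == 0) * p i +
    \sum_(z <- xq) (a == z.1) * z.2 i.
Proof.
move=> HT a i le; have [->|a0] := posnP a.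
  by rewrite -H0 HT // mul1n; congr addn; apply: eq_bigr => z _;
    rewrite leqn0 eq_sym.
apply: (@addnI (H a.-1 i)); rewrite -D_H // !HT //= mul0n add0n -addnA.
congr addn; rewrite -big_split /=; apply: eq_bigr => z _.
by rewrite stepE // mulnDl.
Qed.

(** The decomposition of h - delta. *)
Definition D2_codim2 a i : nat :=
  (a == 0) * ones 0 s i + (a == w) * ones 1 (u + v + 2) i
  + (a == w + v - 1) * ones 2 (u + 2) i.

Lemma onesT l r i : l <= i -> i <= r -> ones l r i = 1.
Proof. by rewrite /ones => -> ->. Qed.
Lemma onesFl l r i : i < l -> ones l r i = 0.
Proof. by rewrite /ones ltnNge => /negPf ->. Qed.
Lemma onesFr l r i : r < i -> ones l r i = 0.
Proof. by rewrite /ones ltnNge andbC => /negPf ->. Qed.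

Lemma h_par_ones i : i <= s -> i != 1 ->
  h_par i = ones 0 s i + ones 1 (u + v + 2) i + ones 2 (u + 2) i.
Proof.
move=> le i1; rewrite (onesT (l := 0)) //; case: i i1 le => [|[|i]] // _ le.
have [lt1|le1] := leqP i.+2 (u + 2); first by rewrite h_par_3 // !onesT //; lia.
rewrite (@onesFr _ (u + 2)) //.
have [lt2|le2] := leqP i.+2 (u + v + 2); first by rewrite h_par_2 // !onesT //;
  lia.
by rewrite onesFr // h_par_one.
Qed.

Lemma h_par_onesD1 i : e = 1 -> i <= s ->
  h_par i = ones 0 s i + ones 1 (u + v + 2) i + ones 1 (u + 2) i.
Proof.
move=> e1 le; have [->|i1] := eqVneq i 1.
  by rewrite h_par_1 e1 !onesT ?addn1 // /s; lia.
rewrite h_par_ones //; congr (_ + nat_of_bool _).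
by case: i i1 {le} => [|[|i]].
Qed.

Lemma sdec_eq_D1 : e = 1 ->
  (forall a i, w <= a -> a < w + v -> i <= s -> H a i
    = 1 + ones 1 (u + v + 2) i) ->
  (forall a i, w + v <= a -> i <= s -> H a i = h_par i) ->
  forall a i, D a i = D1 u v w a i.
Proof.
move=> e1 Hmid Hend a i; have [le|lt] := leqP i s; last first.
  rewrite D_gt /D1; last lia.
  by rewrite /s in lt; rewrite !onesFr ?muln0 //; lia.
rewrite (@sdec_of_steps (ones 0 s) [:: (w, ones 1 (u + v + 2));
  (w + v, ones 1 (u + 2))]) //.
  by rewrite !big_cons big_nil addn0 addnA.
move=> {}a {}i {}le; rewrite !big_cons big_nil addn0 /=.
have [lt1|le1] := ltnP a w.
  rewrite H_low // onesT //=.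
  by have -> : (w + v <= a) = false by lia.
rewrite mul1n; have [lt2|le2] := ltnP a (w + v).
  by rewrite Hmid // (onesT (l := 0)) //= addn0.
by rewrite Hend // mul1n h_par_onesD1 // addnA.
Qed.

Lemma sdec_eq_D2 : 0 < v ->
  (forall a i, w <= a -> a < w + v - 1 -> i <= s -> H a i
    = 1 + ones 1 (u + v + 2) i) ->
  (forall a i, w + v - 1 <= a -> i != 1 -> H a i = h_par i) ->
  (forall a, w + v - 1 <= a -> H a 1 = if a < s - 2 then 2 else 2 + e) ->
  forall a i, D a i = D2_codim2 a i + (a == s - 2) * (e * delta i).
Proof.
move=> v0 Hmid Hend Hend1 a i; have [le|lt] := leqP i s; last first.
  rewrite D_gt /D2_codim2; last lia.
  have i1 : i != 1 by rewrite /s in lt; lia.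
  rewrite /delta (negPf i1) !muln0 addn0.
  by rewrite !onesFr ?muln0 //; rewrite /s in lt; lia.
rewrite (@sdec_of_steps (ones 0 s) [:: (w, ones 1 (u + v + 2));
  (w + v - 1, ones 2 (u + 2));
  (s - 2, fun i => e * delta i)]) //.
  by rewrite !big_cons big_nil addn0 !addnA.
move=> {}a {}i {}le; rewrite !big_cons big_nil addn0 /=.
have [lt1|le1] := ltnP a w.
  rewrite H_low // onesT //=.
  have -> : (w + v - 1 <= a) = false by lia.
  by have -> : (s - 2 <= a) = false by rewrite /s; lia.
rewrite mul1n; have [lt2|le2] := ltnP a (w + v - 1).
  rewrite Hmid // (onesT (l := 0)) //=.
  have -> : (s - 2 <= a) = false by rewrite /s; lia.
  by rewrite mul0n addn0.
rewrite mul1n; have [->|i1] := eqVneq i 1.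
  rewrite Hend1 // (onesT (l := 0)) ?(onesT (l := 1)) ?onesFl /delta //=;
    try by rewrite /s; lia.
  by case: ltnP => _ /=; lia.
by rewrite Hend // h_par_ones // /delta (negPf i1) !muln0 addn0 addnA.
Qed.

Theorem sdec_cases : e <= 1 -> (v = 0 -> e = 1) ->
  (e = 1 /\ forall a i, D a i = D1 u v w a i) \/
  (0 < v /\ forall a i, D a i = D2_codim2 a i + (a == s - 2) * (e * delta i)).
Proof.
move=> e1 ve; have [v0|v0] := posnP v.
  left; have {ve}e1' := ve v0; split=> //; apply: sdec_eq_D1 => // a i wa;
    first by lia.
  by move=> _; apply: H_no_two => //; lia.
have flat b : w <= b -> b < w + v -> H b 2 <= 2 ->
    forall i, i <= s -> H b i = 1 + ones 1 (u + v + 2) i.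
  move=> wb bv b2 i le; have [->|i0] := posnP i; first by rewrite H_a0.
  have [iu|ui] := leqP i (u + v + 2).
    by rewrite onesT // H_flat // H_one.
  by rewrite onesFr // H_end_w // h_par_one.
have := @H_ge2 v0 (w + v - 1) 2 _ _ _; have := H_le (w + v - 1) 2.
rewrite h_par_3; try lia; move=> le3 ge2.
have [b2|b3] : H (w + v - 1) 2 = 2 \/ H (w + v - 1) 2 = 3 by lia.
  left; have [e0 top] := H_b0_eq2 v0 b2; have e1' : e = 1 by lia.
  split=> //; apply: sdec_eq_D1 => // a i wa.
    move=> av; apply: flat => //; apply: leq_trans (_ : H (w + v - 1) 2 <= _);
      last by rewrite b2.
    by apply: H_mono; lia.
  by move=> _; apply: H_eq wa _; apply: top.
right; split=> //; have [stab stab1] := H_b0_eq3 v0 b3.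
apply: sdec_eq_D2 => // a i wa av; apply: flat => //; first by lia.
by rewrite H_two //; lia.
Qed.
End Numerics.

(** * Subsets and subspaces *)
Section Transfer.
Variables (K : fieldType) (A : comFalgType K).
Implicit Types (U V : {vspace A}).

Lemma ideal_mul_vset U V : ideal_mul (vset U) (vset V) = vset (U * V)%VS.
Proof.
apply/seteqP; split=> x /=.
  case=> s [sP ->]; rewrite /vset /= big_seq memv_suml // => p /sP[pU pV].
  exact: memv_mul.
rewrite /vset /=; move: x; apply: prodv_ind
  => [|c x y [s [sP ->]] [t [tP ->]]|x y Ux Vy].
- by exists [::]; rewrite big_nil.
- exists ([seq (c *: p.1, p.2) | p <- s] ++ t); split.
    move=> p; rewrite mem_cat => /orP[/mapP[q /sP[q1 q2] ->]|/tP//];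
      split=> //=.
    exact: memvZ.
  rewrite big_cat big_map scaler_sumr; congr (_ + _); apply: eq_bigr => p _.
  by rewrite scalerAl.
- exists [:: (x, y)]; rewrite big_seq1; split=> // p.
  by rewrite inE => /eqP ->.
Qed.

Lemma annihilator_vset U : annihilator (vset U) = vset (annv U).
Proof.
by apply/seteqP; split=> x => [xU|/annvP xU]; [apply/annvP|] => u; apply: xU.
Qed.

Variable m : {vspace A}.
Hypothesis mP : nonunits A = vset m.

Lemma maxideal_pow_vset t : maxideal_pow A t = vset (mpow m t).
Proof.
elim: t => [|t IHt] /=; last by rewrite IHt mP ideal_mul_vset.
by apply/seteqP; split=> x // _; rewrite /vset /= memvf.
Qed.

Lemma C_lift_vset s a i : C_lift (A := A) s a i = vset (Cspace m s a i).
Proof.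
rewrite /C_lift !maxideal_pow_vset annihilator_vset.
apply/seteqP; split=> x.
  case=> y [ya yi] yx; rewrite /vset /= -(subrK y x) addrC memv_add //.
  by rewrite memv_cap ya yi.
case/memv_addP=> y /memv_capP[ya yi] [z zi ->].
by exists y => //; rewrite /vset /= addrAC subrr add0r.
Qed.

End Transfer.

(** Here s is the socle degree, h is the Hilbert function, and lg_soc is the
    Gorenstein property. *)
Record local_gorenstein (K : fieldType) (A : comFalgType K) (m : {vspace A}) s
  h : Prop :=
  LocalGorenstein {
    lg_mP : nonunits A = vset m;
    lg_ideal : idealv m;
    lg_res : (\dim m + 1)%N = \dim {:A};
    lg_s1 : mpow m s.+1 = 0%VS;
    lg_s : mpow m s != 0%VS;
    lg_soc : \dim (annv m) = 1%N;
    lg_hf : forall i, (\dim (mpow m i.+1) + h i)%N = \dim (mpow m i) }.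

Lemma local_gorensteinP (K : fieldType) (A : comAlgType K) h s :
  artinian_gorenstein A -> hilbert_function A h ->
  h 0%N = 1%N -> (0 < h s)%N -> (forall i, (s < i)%N -> h i = 0%N) ->
  exists (B : comFalgType K) (m : {vspace B}),
    B = A :> comAlgType K /\ local_gorenstein m s h.
Proof.
case=> artA locA socA HF h0 hs hgt.
have [B def_A] := artinian_com_falgebra artA locA HF hgt.
case: A / def_A artA locA socA HF => artB locB socB HF.
have [n0 nD nM] := locB.
have [|m mP] := @vspace_of_set K B _ n0.
  by move=> a x y nx ny; apply: nD => //; rewrite -mulr_algl; apply: nM.
have m_ideal : idealv m by move=> a x; have := nM a x; rewrite mP; apply.
have hf i : (\dim (mpow m i.+1) + h i)%N = \dim (mpow m i).
  by apply/quotient_dimP; [apply: mpowS | rewrite -!maxideal_pow_vset].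
exists B, m; split=> //; split=> //.
- by have := hf 0%N; rewrite h0 mpow1.
- apply/eqP; rewrite -subv0; apply/subvP=> x xs; rewrite memv0; apply/eqP.
  apply: (artinian_nilpotent artB locB (N := s.+1));
    last by rewrite (maxideal_pow_vset mP).
  move=> y; rewrite !(maxideal_pow_vset mP) => ys.
  suff /eqP -> : mpow m s.+2 == mpow m s.+1 by [].
  by rewrite eqEdim mpowS //= -(hf s.+1) hgt // addn0.
- by rewrite -dimv_eq0 -(hf s); lia.
- have qd : quotient_dim (vset (annv m)) (vset 0%VS) 1.
    rewrite -annihilator_vset -mP.
    suff <- : [set 0]%classic = vset (0%VS : {vspace B}) by [].
    by apply/seteqP; split=> x /=; rewrite /vset /= memv0 => /eqP.
  by have [+ _] := quotient_dimP 1 (sub0v (annv m));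
    rewrite dimv0 => /(_ qd) <-.
Qed.

Section LocalGorensteinTransfer.
Variables (K : fieldType) (A : comFalgType K) (m : {vspace A}) (s : nat) (h :
  nat -> nat).
Hypothesis G : local_gorenstein m s h.

Lemma socle_degree_lg : socle_degree A s.
Proof.
have [mP m_ideal _ ms1 ms _ _] := G; split.
  move=> sub; case/negP: ms; rewrite -subv0; apply/subvP=> x xs.
  by rewrite memv0; apply/eqP/sub; rewrite (maxideal_pow_vset mP).
move=> j sj x; rewrite (maxideal_pow_vset mP) => xj.
by apply/eqP; rewrite -memv0 -ms1; apply: memv_sub xj; apply: mpow_le.
Qed.

Lemma quotient_dim_C_lift a i : quotient_dim (C_lift (A
  := A) s a i) (C_lift s a.+1 i) (sdec m s a i).
Proof.
rewrite !(C_lift_vset (lg_mP G)); have mI := lg_ideal G.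
have le : (Cspace m s a.+1 i <= Cspace m s a i)%VS by apply: CspaceS.
by apply/quotient_dimP => //; rewrite subnKC ?dimvS.
Qed.

Lemma symmetric_decomposition_sdec D :
  (forall a i, (a.+2 <= s)%N -> D a i = sdec m s a i)
    -> symmetric_decomposition A D.
Proof.
move=> eqD; exists s; first exact: socle_degree_lg.
by move=> a i le; rewrite eqD //; apply: quotient_dim_C_lift.
Qed.

Lemma symmetric_decomposition_uniq D : symmetric_decomposition A D ->
  forall a i, (a.+2 <= s)%N -> D a i = sdec m s a i.
Proof.
case=> s' [ns' gts'] DP a i le.
have [ns gts] := socle_degree_lg.
have eqs : s' = s.
  apply/eqP; rewrite eqn_leq; apply/andP; split; rewrite leqNgt;
    apply/negP => lt.
    by apply: ns'; apply: gts.
  by apply: ns; apply: gts'.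
have := DP a i; rewrite eqs => /(_ le); have := quotient_dim_C_lift a i.
by rewrite (C_lift_vset (lg_mP G) _ a.+1) => q1 q2;
  apply: quotient_dim_uniq q2 q1.
Qed.

End LocalGorensteinTransfer.

Lemma sdec_dichotomy (K : fieldType) (A : comFalgType K) (m : {vspace A}) u v w
  e :
  (e <= 1)%N -> (v = 0%N -> e = 1%N) ->
  let s := (u + v + w + 3)%N in
  local_gorenstein m s (h_par u v w e) ->
  (e = 1%N /\ forall a i, sdec m s a i = D1 u v w a i) \/
  ((0 < v)%N /\ forall a i, sdec m s a i =
     (D2_codim2 u v w a i + (a == s - 2) * (e * delta i))%N).
Proof.
move=> e1 ve s [mP mI res s1 sn soc hf].
apply: (@sdec_cases u v w e (sdec m s) (hf_quot m s)) => //.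
- by move=> a i; apply: sdec_sym.
- by move=> a i; apply: sdec_gt.
- exact: sdec00.
- by move=> a a0; apply: sdec_a0.
- by move=> i; apply: hf_quot0.
- by move=> b i; apply: hf_quotS.
- by move=> b i sb; rewrite hf_quot_full // -hf; lia.
- by move=> b i c ci c2; apply: hf_quot_growth.
Qed.

(** * Connected sums *)
Section ConnectedSum.
Variables (K : fieldType) (A : comFalgType K) (m : {vspace A}) (s : nat) (h :
  nat -> nat).
Hypothesis G : local_gorenstein m s h.
Local Notation M := (mpow m).

(** In a Gorenstein algebra with s > 1, this says that the algebra is the
    connected sum, along their socles, of the subalgebra generated by x and
    y and of K[z]/(z^3). *)
Record connected_sum_basis (x y z : A) : Prop := ConnectedSumBasis {
  cs_x : x \in m;
  cs_y : y \in m;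
  cs_z : z \in m;
  cs_xz : x * z = 0;
  cs_yz : y * z = 0;
  cs_m2z : forall t, t \in M 2 -> t * z = 0;
  cs_z2 : z * z \in M s;
  cs_gen : m = (M 2 + <[x]> + <[y]> + <[z]>)%VS;
  cs_nx : x \notin M 2;
  cs_ny : y \notin (M 2 + <[x]>)%VS;
  cs_nz : z \notin (M 2 + <[x]> + <[y]>)%VS }.

(** C(s-2)_1 is a line, spanned by some z in (0 : m^2) outside m^2. As
    m^2 = (0 : (0 : m^2)), some y in (0 : m^2) has zy <> 0, and y is in
    m^2 + <z>: so z^2 <> 0 spans the socle. Multiplication by z maps m to the
    socle, hence m is the sum of <z> and of its kernel, which contains m^2. *)
Lemma connected_sum : (1 < s)%N -> h 1%N = 3%N -> sdec m s (s - 2) 1 = 1%N ->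
  exists x y z, connected_sum_basis x y z.
Proof.
move=> s1 h1; have [mP mI res ms1 ms soc hf] := G.
have M2I : idealv (M 2) by move=> ? ?; apply: mpow_ideal.
have M2m : (M 2 <= m)%VS by have := mpowS mI 1; rewrite (mpow1 mI).
have Mm2 a b : a \in m -> b \in m -> a * b \in M 2.
  by move=> am bm; apply: (mpowM mI (i := 1) (j := 1)); rewrite (mpow1 mI).
have socE : annv m = M s by apply: socle_eq ms1 ms soc.
have annM2 : (annv (M 2) <= m)%VS by apply: (@annv_sub_m K A m s).
have -> : sdec m s (s - 2) 1 = (\dim (annv (M 2) + M 2) - \dim (M 2))%N.
  rewrite /sdec /Cspace (_ : s.+1 - (s - 2) - 1 = 2)%N; last lia.
  rewrite (_ : s.+1 - (s - 2).+1 - 1 = 1)%N; last lia.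
  rewrite (mpow1 mI) (capv_idPl annM2); congr (_ - \dim _)%N.
  apply/addv_idPr/(subv_trans (capvSl _ _)); rewrite socE; exact: mpow_le.
move=> dim1.
have leS := dimvS (addvSr (annv (M 2)) (M 2)).
have [z [zM2 zN]] : exists z, z \in annv (M 2) /\ z \notin M 2.
  apply: contrapT => no; have : (annv (M 2) <= M 2)%VS.
    by apply/subvP=> z za; apply: contraT => zN; case: no; exists z.
  by move/addv_idPr => eqM; move: dim1; rewrite eqM subnn.
have annz : (annv (M 2) <= M 2 + <[z]>)%VS.
  apply: subv_trans (addvSl _ (M 2)) _; apply: sub_add_line => //.
  - exact: addvSr.
  - by move: dim1; lia.
  - by apply: memv_sub zM2; apply: addvSl.
have zM2' t : t \in M 2 -> t * z = 0 by move=> tM;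
  rewrite mulrC (annvP _ _ zM2).
have zm : z \in m by apply: memv_sub zM2.
have z2 : z * z != 0.
  have [phi phi_nd] := dualizing_form ms1 soc.
  apply: contraNneq zN => z20; rewrite -(annvK phi_nd M2I).
  apply/annvP=> y /(memv_sub annz)/memv_addP[t tM [_ /vlineP[c ->] ->]].
  by rewrite mulrDr -scalerAr z20 scaler0 addr0 mulrC zM2'.
have zsoc t : t \in m -> t * z \in annv m.
  move=> tm; apply/annvP=> r rm; rewrite mulrAC; apply: zM2'; exact: Mm2.
have socz : annv m = <[z * z]>%VS.
  apply/esym/eqP; rewrite eqEdim -memvE zsoc // soc dim_vline z2. by [].
pose N := (annv <[z]> :&: m)%VS.
have inN t : (t \in N) = (t \in m) && (t * z == 0).
  rewrite memv_cap andbC; congr andb; apply/annvP/eqP => [|tz _ /vlineP[c ->]].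
    by apply; apply: memv_line.
  by rewrite -scalerAr tz scaler0.
have M2N : (M 2 <= N)%VS.
  by apply/subvP=> t tM; rewrite inN zM2' // eqxx andbT (memv_sub M2m).
have zNN : z \notin N by rewrite inN zm.
have mN : m = (N + <[z]>)%VS.
  apply/eqP; rewrite eqEsubv subv_add capvSr -memvE zm !andbT.
  apply/subvP=> t tm; have := zsoc t tm; rewrite socz => /vlineP[c tz].
  rewrite -(subrK (c *: z) t) memv_add ?memvZ ?memv_line // inN memvB ?memvZ
    //=.
  by rewrite mulrBl -scalerAl tz subrr.
have dimN : \dim N = (\dim (M 2) + 2)%N.
  have := dimv_add_line_notin zNN; rewrite -mN => dm.
  by have := hf 1%N; rewrite h1 (mpow1 mI) dm; clear; lia.
have [x [xN xM]] : exists x, x \in N /\ x \notin M 2.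
  apply: contrapT => no; have /dimvS : (N <= M 2)%VS; last by rewrite dimN;
    clear; lia.
  by apply/subvP=> x xN; apply: contraT => xM; case: no; exists x.
have [y [yN yM]] : exists y, y \in N /\ y \notin (M 2 + <[x]>)%VS.
  apply: contrapT => no; have /dimvS : (N <= M 2 + <[x]>)%VS.
    by apply/subvP=> y yN; apply: contraT => yM; case: no; exists y.
  by rewrite dimN dimv_add_line_notin //; clear; lia.
have NE : N = (M 2 + <[x]> + <[y]>)%VS.
  apply/esym/eqP; rewrite eqEdim !subv_add M2N -!memvE xN yN /=.
  by rewrite !dimv_add_line_notin // dimN -addnA.
move: (xN) (yN); rewrite !inN => /andP[xm /eqP xz] /andP[ym /eqP yz].
exists x, y, z; split=> //; first by rewrite -socE zsoc.
  by rewrite -NE.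
by rewrite -NE.
Qed.
End ConnectedSum.

(** * The order of a power series *)
Section PowerSeriesOrder.
Variables (n : nat) (K : fieldType).
Local Notation R := {powerseries K[n]}.
Implicit Types (f g : R) (k : 'X_{1..n}).

Lemma pscoefM f g k : pscoef (f * g) k =
  \sum_(p : 'X_{1..n < (mdeg k).+1} * 'X_{1..n < (mdeg k).+1} | k == (p.1
    + p.2)%MM)
     pscoef f p.1 * pscoef g p.2.
Proof. by []. Qed.

Lemma pscoef1 k : pscoef (1 : R) k = (k == 0%MM)%:R.
Proof. by []. Qed.

Lemma pscoef_sum (I : Type) (r : seq I) (P : pred I) (F : I -> R) k :
  pscoef (\sum_(i <- r | P i) F i) k = \sum_(i <- r | P i) pscoef (F i) k.
Proof. by elim/big_ind2: _ => // f1 c1 f2 c2 <- <-. Qed.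

Definition ps_order_ge t f := forall k, (mdeg k < t)%N -> pscoef f k = 0.

Lemma ps_order_geD t f g : ps_order_ge t f -> ps_order_ge t g
  -> ps_order_ge t (f + g).
Proof. by move=> tf tg k lt; rewrite /= tf ?tg ?addr0. Qed.

Lemma ps_order_ge_zero t : ps_order_ge t 0. Proof. by []. Qed.

Lemma ps_order_geZ t (c : K) f : ps_order_ge t f -> ps_order_ge t (c *: f).
Proof. by move=> tf k lt; rewrite /= tf ?mulr0. Qed.

Lemma ps_order_ge_le i j f : (i <= j)%N -> ps_order_ge j f -> ps_order_ge i f.
Proof. by move=> le jf k lt; apply: jf; apply: leq_trans le. Qed.

Lemma ps_order_geM i j f g : ps_order_ge i f -> ps_order_ge j g
  -> ps_order_ge (i + j) (f * g).
Proof.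
move=> fi gj k lt; rewrite pscoefM big1 // => p /eqP def_k.
have [/fi ->|le1] := ltnP (mdeg p.1) i; first by rewrite mul0r.
have [/gj ->|le2] := ltnP (mdeg p.2) j; first by rewrite mulr0.
by have e := congr1 (@mdeg n) def_k; rewrite e mdegD ltnNge leq_add in lt.
Qed.

Lemma pscoefM0 f g : pscoef (f * g) 0%MM = pscoef f 0%MM * pscoef g 0%MM.
Proof.
have lt0 : (mdeg (0%MM : 'X_{1..n}) < (mdeg (0%MM : 'X_{1..n})).+1)%N by [].
pose b := BMultinom lt0.
rewrite pscoefM (bigD1 (b, b)) /= ?addm0 // big1 ?addr0 //
  => -[p q] /= /andP[/eqP e].
have /eqP : (mdeg p + mdeg q = 0)%N by rewrite -mdegD -e mdeg0.
rewrite addn_eq0 !mdeg_eq0 => /andP[p0 q0]; case/eqP.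
by congr pair; apply/val_inj/eqP.
Qed.

Lemma ps_order_ge1 f : ps_order_ge 1 f <-> pscoef f 0%MM = 0.
Proof.
split=> [f1|f0 k]; first by apply: f1; rewrite mdeg0.
by rewrite ltnS leqn0 mdeg_eq0 => /eqP ->.
Qed.

Lemma pscoefM_low f g g' k : (forall k', (mdeg k' <= mdeg k)%N -> pscoef g k'
  = pscoef g' k') ->
  pscoef (f * g) k = pscoef (f * g') k.
Proof.
by move=> gg; rewrite !pscoefM; apply: eq_bigr => p _;
  rewrite gg // -ltnS bmdeg.
Qed.

(** The geometric series in 1 - f, after scaling f to have constant term 1. It
    is defined coefficientwise, the coefficient of degree d of the powers of
    exponent > d being 0. *)
Lemma ps_unit f : pscoef f 0%MM != 0 -> exists g, f * g = 1.
Proof.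
suff unit1 f' : pscoef f' 0%MM = 1 -> exists g, f' * g = 1.
  move=> f0; have [|g fg] := unit1 ((pscoef f 0%MM)^-1 *: f);
    first by rewrite /= mulVf.
  by exists ((pscoef f 0%MM)^-1 *: g); rewrite -scalerAr scalerAl.
move=> f0; pose N := 1 - f'.
have N1 : ps_order_ge 1 N by apply/ps_order_ge1; rewrite /= f0 eqxx subrr.
have Nt t : ps_order_ge t (N ^+ t).
  by elim: t => // t IHt; rewrite exprS; apply: (ps_order_geM (i := 1)).
pose S t := \sum_(i < t) N ^+ i.
have geo t : f' * S t = 1 - N ^+ t.
  have -> : f' = 1 - N by rewrite /N opprB addrC subrK.
  by rewrite -[1 in RHS](expr1n _ t) subrXX; congr (_ * _);
    apply: eq_bigr => i _; rewrite expr1n mul1r.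
exists (PowerSeries (fun k => pscoef (S (mdeg k).+1) k));
  apply: powerseriesP => k.
rewrite (@pscoefM_low _ _ (S (mdeg k).+1)).
  by rewrite geo /= Nt ?subr0.
move=> k' le /=; rewrite !pscoef_sum.
rewrite (big_ord_widen (mdeg k).+1 (fun i
  => pscoef (N ^+ i) k')) // big_mkcond /=.
apply: eq_bigr => i _; case: ifP => // /negbT; rewrite -leqNgt => lt.
by rewrite (Nt i).
Qed.

Definition psX (i : 'I_n) : R := PowerSeries (fun k => (k == U_(i)%MM)%:R).

Lemma ps_order_ge1_psX i : ps_order_ge 1 (psX i).
Proof.
by apply/ps_order_ge1 => /=; case: eqP => // /(congr1 (@mdeg n));
  rewrite mdeg0 mdeg1.
Qed.

Lemma pscoefX_mul i g k : pscoef (psX i * g) k =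
  if (k i == 0)%N then 0 else pscoef g (k - U_(i))%MM.
Proof.
rewrite pscoefM; case: ifP => [/eqP ki0|/negbT ki].
  rewrite big1 // => p /eqP def_k /=; case: eqP => [e|_]; last by rewrite mul0r.
  by have := congr1 (fun k' : 'X_{1..n} => k' i) def_k;
    rewrite mnmDE e mnm1E eqxx ki0.
have leU : (U_(i) <= k)%MM by rewrite lep1mP.
have kE : k = (U_(i) + (k - U_(i)))%MM by rewrite addmC submK.
have b1 : (mdeg (U_(i)%MM : 'X_{1..n}) < (mdeg k).+1)%N
  by rewrite kE mdegD ltnS leq_addr.
have b2 : (mdeg (k - U_(i))%MM < (mdeg k).+1)%N
  by rewrite {2}kE mdegD ltnS leq_addl.
rewrite (bigD1 (BMultinom b1, BMultinom b2)) /=; last by rewrite -kE.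
rewrite eqxx mul1r big1 ?addr0 // => -[p q] /= /andP[/eqP def_k neq].
case: eqP => [e|_]; last by rewrite mul0r.
case/eqP: neq; congr pair; apply: val_inj => //=.
by have := congr1 (fun k' => k' - U_(i))%MM def_k; rewrite e addmC addmK.
Qed.

(** The monomial of exponent k goes to the first variable that divides it. *)
Lemma ps_order_geS t f : ps_order_ge t.+1 f ->
  exists g : 'I_n -> R, (forall i, ps_order_ge t (g i)) /\ f
    = \sum_i psX i * g i.
Proof.
move=> ft.
pose first (i : 'I_n) (k : 'X_{1..n}) := [forall j : 'I_n, (j < i)%N ==> (k j
  == 0)%N].
exists (fun i => PowerSeries (fun k => if first i k then pscoef f (k
  + U_(i))%MM else 0)).
split=> [i k lt /=|].
  by case: ifP => // _; apply: ft; rewrite mdegD mdeg1 addn1.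
apply: powerseriesP => k; rewrite pscoef_sum.
under eq_bigr do rewrite pscoefX_mul /=.
have [k0|k0] := eqVneq k 0%MM.
  rewrite big1 ?ft ?k0 ?mdeg0 // => i _; by rewrite mnm0E.
have [i0 ki0 min0] : exists2 i0, k i0 != 0%N & forall j : 'I_n, (j < i0)%N
  -> k j = 0%N.
  have [j kj] : exists j, k j != 0%N.
    apply/existsP; apply: contraNT k0; rewrite negb_exists => /forallP kk.
    by apply/eqP/mnmP => j; rewrite mnm0E; apply/eqP; rewrite -[_ == _]negbK.
  case: (arg_minnP (fun i : 'I_n => i : nat) (P := fun i => k i != 0%N) kj)
    => i ki mini.
  exists i => // l lt; apply/eqP; apply: contraTT lt => kl; rewrite -leqNgt;
    exact: mini.
rewrite (bigD1 i0) //= (negPf ki0) ifT; last first.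
  apply/forallP => j; apply/implyP => lt; rewrite mnmBE min0 //.
rewrite submK ?lep1mP // big1 ?addr0 // => i neq.
case: eqP => // /eqP ki; rewrite ifF //; apply/negbTE.
rewrite negb_forall; apply/existsP; exists i0; rewrite negb_imply.
have -> : (i0 < i)%N.
  rewrite ltn_neqAle eq_sym neq /= leqNgt; apply: contra ki => lt;
    by rewrite min0.
by rewrite mnmBE mnm1E (negPf neq) subn0.
Qed.
End PowerSeriesOrder.

(** * Quotients of power series rings *)
Section PowerSeriesQuotient.
Variables (n : nat) (K : fieldType) (I : idealr {powerseries K[n]}).
Local Notation R := {powerseries K[n]}.
Local Notation Q := {ideal_quot I}.
Implicit Types (f g : R).
Local Open Scope quotient_scope.

Definition iq_pi f : Q := \pi_Q f.
Local Notation pi := iq_pi.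

Lemma iq_piD f g : pi (f + g) = pi f + pi g. Proof. exact: rmorphD. Qed.
Lemma iq_piB f g : pi (f - g) = pi f - pi g. Proof. exact: rmorphB. Qed.
Lemma iq_piM f g : pi (f * g) = pi f * pi g. Proof. exact: rmorphM. Qed.
Lemma iq_pi1 : pi 1 = 1. Proof. exact: rmorph1. Qed.
Lemma iq_pi_sum (J : Type) (r : seq J) (P : pred J) (F : J -> R) :
  pi (\sum_(i <- r | P i) F i) = \sum_(i <- r | P i) pi (F i).
Proof. exact: rmorph_sum. Qed.
Lemma iq_piZ (c : K) f : pi (c *: f) = c *: pi f.
Proof. by rewrite -[RHS]/(pi c%:A * pi f) -iq_piM -scalerAl mul1r. Qed.

Lemma iq_pi_eq0 f : (pi f == 0) = (f \in I).
Proof.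
have -> : (0 : Q) = pi 0 by apply/esym; apply: rmorph0.
by rewrite -[f in RHS]subr0 Quotient.idealrBE.
Qed.

Lemma iq_pi_surj x : exists f, x = pi f.
Proof. by exists (repr x); rewrite /iq_pi reprK. Qed.

Lemma ideal_order1 f : f \in I -> ps_order_ge 1 f.
Proof.
move=> fI; apply/ps_order_ge1/eqP; apply: contraT => /ps_unit[g fg].
by have := idealMr g fI; rewrite mulrC fg idealr1.
Qed.

Lemma nonunits_pi f : nonunits Q (pi f) <-> ps_order_ge 1 f.
Proof.
split=> [nf|f1 [y]].
  apply/ps_order_ge1/eqP; apply: contraT => /ps_unit[g fg].
  by case: nf; exists (pi g); rewrite -iq_piM fg iq_pi1.
have [g ->] := iq_pi_surj y; rewrite -iq_piM -iq_pi1 => /eqP.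
rewrite -subr_eq0 -iq_piB iq_pi_eq0 => /ideal_order1/ps_order_ge1/eqP.
rewrite -[pscoef _ _]/(pscoef (f * g) 0%MM - pscoef (1 : R) 0%MM) pscoefM0
  pscoef1.
by move/ps_order_ge1: f1 => ->; rewrite mul0r sub0r eqxx oppr_eq0 oner_eq0.
Qed.

Lemma local_ring_iq : local_ring Q.
Proof.
split.
- have -> : (0 : Q) = pi 0 by apply/esym; apply: rmorph0.
  exact/nonunits_pi/ps_order_ge_zero.
- move=> x y; have [f ->] := iq_pi_surj x; have [g ->] := iq_pi_surj y.
  by rewrite -iq_piD !nonunits_pi; apply: ps_order_geD.
- move=> x y; have [f ->] := iq_pi_surj x; have [g ->] := iq_pi_surj y.
  by rewrite -iq_piM !nonunits_pi; apply: (ps_order_geM (i := 0)).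
Qed.

Lemma maxideal_pow_pi t x :
  maxideal_pow Q t x <-> exists2 f, ps_order_ge t f & x = pi f.
Proof.
split; elim: t x => [|t IHt] x.
- by have [f ->] := iq_pi_surj x; exists f.
- case=> s [sP ->]; rewrite big_seq.
  elim/big_ind: _ => [|y z [f ft ->] [g gt ->]|p /sP[p1 p2]].
  + by exists 0; [apply: ps_order_ge_zero | apply/esym; apply: rmorph0].
  + by exists (f + g); rewrite ?iq_piD //; apply: ps_order_geD.
  + have [g gt ->] := IHt _ p2; have [f def_p1] := iq_pi_surj p.1.
    exists (f * g); last by rewrite iq_piM def_p1.
    by apply: (ps_order_geM (i := 1)) => //; apply/nonunits_pi; rewrite -def_p1.
- by [].
- case=> f /ps_order_geS[g [gt ->]] ->.
  exists [seq (pi (psX K i), pi (g i)) | i <- enum 'I_n]; split.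
    move=> _ /mapP[i _ ->]; split=> /=; last by apply: IHt; exists (g i).
    exact/nonunits_pi/ps_order_ge1_psX.
  by rewrite big_map big_enum iq_pi_sum; apply: eq_bigr => i _; rewrite iq_piM.
Qed.
End PowerSeriesQuotient.

(** * Complete intersections *)
Section RegularSequence.
Variable R : comNzRingType.
Implicit Types (fs : seq R) (x : R).

Lemma ideal_span_takeP fs k x : (k <= size fs)%N ->
  ideal_span (take k fs) x <-> exists c : nat -> R, x
    = \sum_(i < k) c i * fs`_i.
Proof.
move=> lek; have szk : size (take k fs) = k by rewrite size_takel.
split.
  case=> c ->; exists (fun i => if insub i is Some j then c j else 0).
  pose F i := (if insub i is Some j then c j else 0) * fs`_i.
  rewrite -[RHS](big_mkord xpredT F) -[X in index_iota 0 X]szk big_mkord /F.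
  by apply: eq_bigr => i _; rewrite valK nth_take // -[X in (_ < X)%N]szk.
case=> c ->; exists (fun i => c i).
rewrite -(big_mkord xpredT (fun i => c i * fs`_i)) -[X in index_iota 0 X]szk
  big_mkord.
by apply: eq_bigr => i _; rewrite nth_take // -[X in (_ < X)%N]szk.
Qed.

(** The coefficients of a syzygy of a regular sequence lie in the ideal that it
    generates. By induction: the last coefficient c_k is a combination
    sum_i d_i f_i of the previous elements, and the c_i + d_i f_k form a syzygy
    of these. *)
Lemma regular_sequence_syzygy fs : regular_sequence fs ->
  forall c : nat -> R, \sum_(i < size fs) c i * fs`_i = 0 ->
  forall i, (i < size fs)%N -> ideal_span fs (c i).
Proof.
case=> reg _.
suff prefix k : (k <= size fs)%N -> forall c : nat
  -> R, \sum_(i < k) c i * fs`_i = 0 ->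
    forall i, (i < k)%N -> ideal_span (take k fs) (c i).
  by move=> c c0 i lt; have := prefix _ (leqnn _) c c0 i lt; rewrite take_size.
elim: k => // k IHk lek c.
rewrite big_ord_recr /= => /eqP; rewrite addr_eq0 => /eqP sum0.
have /(ideal_span_takeP _ (ltnW lek))[d ck] : ideal_span (take k fs) (c k).
  apply: reg => //; apply/(ideal_span_takeP _ (ltnW lek)).
  exists (fun i => - c i); rewrite -[LHS]opprK -sum0 -sumrN.
  by apply: eq_bigr => i _; rewrite mulNr.
have widen x : ideal_span (take k fs) x -> ideal_span (take k.+1 fs) x.
  move/(ideal_span_takeP _ (ltnW lek)) => [b ->];
    apply/(ideal_span_takeP _ lek).
  exists (fun i => if (i < k)%N then b i else 0);
    rewrite big_ord_recr /= ltnn mul0r addr0.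
  by apply: eq_bigr => i _; rewrite ltn_ord.
have IH := IHk (ltnW lek) (fun i => c i + d i * fs`_k) _.
move=> i; rewrite ltnS leq_eqVlt => /orP[/eqP ->|ltik].
  by apply: widen; apply/(ideal_span_takeP _ (ltnW lek)); exists d.
have /IH/(_ i ltik) : \sum_(i < k) (c i + d i * fs`_k) * fs`_i = 0.
  under eq_bigr do rewrite mulrDl.
  rewrite big_split /= sum0 ck mulr_suml addrC -sumrB big1 // => j _.
  by rewrite mulrAC subrr.
case/(ideal_span_takeP _ (ltnW lek)) => b eqb; apply/(ideal_span_takeP _ lek).
exists (fun j => if (j < k)%N then b j else - d i).
rewrite big_ord_recr /= ltnn (eq_bigr (fun j : 'I_k => b j * fs`_j));
  last first.
  by move=> j _; rewrite ltn_ord.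
by rewrite -eqb mulNr addrK.
Qed.
End RegularSequence.

(** In a quotient of a power series ring by an ideal of order at least 2, this
    is a pair of quadrics xz, yz in the ideal with a linear syzygy. *)
Definition killed_linear_form (K : fieldType) (A : comAlgType K) : Prop :=
  exists x y z : A,
    [/\ nonunits A x, nonunits A y & nonunits A z] /\
    [/\ x * z = 0, y * z = 0, ~ maxideal_pow A 2 z &
      forall a b : K, maxideal_pow A 2 (a *: x + b *: y) -> a = 0 /\ b = 0].

(** The space m / m^2 has dimension at least 3. It is stated without bases, to
    be used in quotients of power series rings. *)
Definition not_two_generated (K : fieldType) (A : comAlgType K) : Prop :=
  forall g : 'I_2 -> A, exists2 t, nonunits A t &
    forall c : 'I_2 -> K, ~ maxideal_pow A 2 (t - \sum_i c i *: g i).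

Section CompleteIntersection.
Variables (n : nat) (K : fieldType).
Local Notation R := {powerseries K[n]}.
Implicit Types (f g : R) (k : 'X_{1..n}).

Lemma mcoeff_ps_trunc_ge d f k : (d <= mdeg k)%N -> (ps_trunc d f)@_k = 0.
Proof.
move=> le; rewrite /ps_trunc raddf_sum /= big1 // => b _.
rewrite mcoeffZ mcoeffX; case: eqP => [e|_]; last by rewrite mulr0.
by have := bmdeg b; rewrite e ltnNge le.
Qed.

(** The product of the linear parts, seen as polynomials, is zero, and
    polynomials over a field form a domain. *)
Lemma ps_order1_mul f g : ps_order_ge 1 f -> ps_order_ge 1 g ->
  ps_order_ge 3 (f * g) -> ps_order_ge 2 f \/ ps_order_ge 2 g.
Proof.
move=> f1 g1 fg3.
have trunc0 (h : R) : ps_trunc 2 h = 0 -> ps_order_ge 2 h.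
  by move=> h0 k lt; rewrite -(mcoeff_ps_trunc h lt) h0 mcoeff0.
suff /eqP : ps_trunc 2 f * ps_trunc 2 g = 0.
  by rewrite mulf_eq0 => /orP[] /eqP /trunc0; [left | right].
have coef1 (h : R) k : ps_order_ge 1 h -> (mdeg k != 1)%N -> (ps_trunc 2 h)@_k
  = 0.
  move=> h1 k1; have [lt|] := ltnP (mdeg k) 2; last by move=> le;
    rewrite (mcoeff_ps_trunc_ge _ le).
  by rewrite mcoeff_ps_trunc // h1 //; lia.
apply/mpolyP => k; rewrite mcoeff0 mcoeffM.
have [lt|le] := ltnP (mdeg k) 3; last first.
  rewrite big1 // => p /eqP def_k; have := congr1 (@mdeg n) def_k;
    rewrite mdegD => dk.
  have [d1|/coef1 ->] := eqVneq (mdeg p.1) 1%N; rewrite ?mul0r //.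
  rewrite (coef1 g) ?mulr0 //; apply/eqP => d2.
  by move: le; rewrite dk d1 d2.
transitivity (pscoef (f * g) k); last exact: fg3.
rewrite pscoefM; apply: eq_bigr => p /eqP def_k.
have := congr1 (@mdeg n) def_k; rewrite mdegD => dk.
have [d1|d1] := eqVneq (mdeg p.1) 1%N; last first.
  rewrite (coef1 f) // mul0r; have [d0|d2] := eqVneq (mdeg p.1) 0%N.
    by rewrite f1 ?mul0r // d0.
  rewrite (g1 p.2) ?mulr0 //; rewrite dk in lt;
    move: (mdeg p.1) (mdeg p.2) d1 d2 lt.
  by clear; lia.
have [d2|d2] := eqVneq (mdeg p.2) 1%N.
  by rewrite !mcoeff_ps_trunc ?d1 ?d2.
rewrite (coef1 g) // (g1 p.2) ?mulr0 //; rewrite dk d1 in lt.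
by move: (mdeg p.2) d2 lt; clear; lia.
Qed.

Lemma ps_linear_part f : ps_order_ge 1 f ->
  ps_order_ge 2 (f - \sum_i pscoef f U_(i)%MM *: psX K i).
Proof.
move=> f1 k lt.
rewrite -[LHS]/(pscoef f k - pscoef (\sum_i pscoef f U_(i)%MM *: psX K i) k)
  pscoef_sum.
have [d0|d1] := eqVneq (mdeg k) 0%N.
  rewrite f1 ?d0 // big1 ?subrr // => i _ /=.
  by case: eqP => [e|_]; rewrite ?mulr0 //; move: d0; rewrite e mdeg1.
have /mdeg1P[j /eqP ->] : mdeg k == 1%N by lia.
rewrite (bigD1 j) //= eqxx mulr1 big1 ?addr0 ?subrr // => i neq.
case: eqP => [e|_]; last by rewrite mulr0.
by have := congr1 (fun k' : 'X_{1..n} => k' i) e;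
  rewrite !mnm1E eqxx eq_sym (negPf neq).
Qed.
End CompleteIntersection.

Section CompleteIntersection3.
Variables (K : fieldType) (I : idealr {powerseries K[3]}).
Local Notation R := {powerseries K[3]}.
Local Notation Q := {ideal_quot I}.
Local Notation pi := (@iq_pi 3 K I).

(** A nonzero linear term of an element of the ideal would express one of the
    three variables in terms of the two others modulo m^2. *)
Lemma ideal_order2 f : not_two_generated Q -> f \in I -> ps_order_ge 2 f.
Proof.
move=> ntg fI; have f1 := ideal_order1 fI.
suff lin0 i : pscoef f U_(i)%MM = 0.
  have := ps_linear_part f1; rewrite big1 ?subr0 // => i _.
  by rewrite lin0 scale0r.
apply/eqP; apply: contraT => fi0.
have [t nt tP] := ntg (fun j => pi (psX K (lift i j))).
have [g def_t] := iq_pi_surj t; move: nt tP;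
  rewrite def_t => /nonunits_pi g1 tP.
pose a := pscoef g U_(i)%MM / pscoef f U_(i)%MM.
case: (tP (fun j => pscoef g U_(lift i j)%MM - a * pscoef f U_(lift i j)%MM)).
apply/maxideal_pow_pi.
exists ((g - \sum_j pscoef g U_(j)%MM *: psX K j) + (- a) *: (f -
  \sum_j pscoef f U_(j)%MM *: psX K j)).
  apply: ps_order_geD; first exact: ps_linear_part.
  exact/ps_order_geZ/ps_linear_part.
have -> : pi g = pi (g - a *: f).
  by rewrite iq_piB iq_piZ; have := fI; rewrite -iq_pi_eq0 => /eqP ->;
    rewrite scaler0 subr0.
under eq_bigr do rewrite -iq_piZ scalerBl -scalerA.
rewrite -iq_pi_sum -iq_piB sumrB -scaler_sumr; congr pi.
rewrite !(bigD1_ord i) //=; set Sg := \sum_(j < 2) _; set Sf := \sum_(j < 2) _.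
have gi : pscoef g U_(i)%MM = a * pscoef f U_(i)%MM by rewrite mulfVK.
rewrite gi -scalerA; set p := pscoef f _ *: _.
rewrite scaleNr -[RHS]addrA -[LHS]addrA; congr (g + _).
rewrite scalerBr scalerDr !opprB !opprD;
  move: (a *: p) (a *: f) (a *: Sf) => p' f' Sf'.
rewrite -[p' + Sf' - f']addrA addrACA addNr add0r.
by rewrite addrCA [RHS]addrCA [- f' - _]addrC.
Qed.

(** The quadrics XZ and YZ satisfy the linear syzygy Y(XZ) = X(YZ), whereas the
    syzygies of a regular sequence f have coefficients in the ideal, hence of
    order at least 2. Expressed in terms of f, the quadric XZ therefore has
    coefficients without constant term, and its order is at least 3. *)
Lemma killed_linear_form_not_ci : not_two_generated Q -> killed_linear_form Q ->
  ~ complete_intersection_ideal I.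
Proof.
move=> ntg [x [y [z [[nx ny nz] [xz yz z2 xy]]]]] [_ [fs [reg fsI]]].
have [X defx] := iq_pi_surj x; have [Y defy] := iq_pi_surj y;
  have [Z defz] := iq_pi_surj z.
move: nx ny nz xz yz z2 xy; rewrite {x}defx {y}defy {z}defz.
move=> /nonunits_pi X1 /nonunits_pi Y1 /nonunits_pi Z1 XZ YZ Z2 XY.
have inI f : pi f = 0 -> f \in I by move=> /eqP; rewrite iq_pi_eq0.
have /fsI : X * Z \in I by apply: inI; rewrite iq_piM.
have /fsI : Y * Z \in I by apply: inI; rewrite iq_piM.
rewrite -{1 2}(take_size fs) => /(ideal_span_takeP _ (leqnn _))[be YZE].
move/(ideal_span_takeP _ (leqnn _)) => [al XZE].
have syz := @regular_sequence_syzygy _ _ reg (fun i => Y * al i - X * be i) _.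
have /syz{syz} syz : \sum_(i < size fs) (Y * al i - X * be i) * fs`_i = 0.
  under eq_bigr do rewrite mulrBl -!mulrA.
  by rewrite sumrB -!mulr_sumr -XZE -YZE mulrCA subrr.
have al1 i : (i < size fs)%N -> ps_order_ge 1 (al i).
  move=> lt; apply/ps_order_ge1.
  have /fsI/(ideal_order2 ntg) c2 := syz i lt.
  have cst f : ps_order_ge 1 (f - pscoef f 0%MM *: 1).
    apply/ps_order_ge1; rewrite /= eqxx mulr1 subrr. by [].
  have [|//] := XY (- pscoef (be i) 0%MM) (pscoef (al i) 0%MM).
  rewrite -!iq_piZ -iq_piD; apply/maxideal_pow_pi; eexists; last reflexivity.
  rewrite (_ : _ + _ = (Y * al i - X * be i) - (Y * (al i - pscoef (al i) 0%MM
    *: 1))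
      + X * (be i - pscoef (be i) 0%MM *: 1)).
    apply: ps_order_geD; last exact: (ps_order_geM (i := 1) (j := 1)).
    rewrite -[- (Y * _)]mulN1r; apply: ps_order_geD => //.
    by apply: (ps_order_geM (i := 0) (j := 2)) => //;
      apply: (ps_order_geM (i := 1) (j := 1)).
  rewrite !mulrBr -!scalerAr !mulr1 scaleNr.
  rewrite opprB [X in _ = X + _]addrC [X in _
    = X + _]addrA subrK [RHS]addrA subrK.
  exact: addrC.
have XZ3 : ps_order_ge 3 (X * Z).
  rewrite XZE; elim/big_ind: _ => [|f g|i _];
    [exact: ps_order_ge_zero | exact: ps_order_geD |].
  apply: (ps_order_geM (i := 1) (j := 2)); first exact: al1.
  apply: (ideal_order2 ntg); apply/fsI; rewrite -[X in ideal_span X _]take_size.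
  apply/(ideal_span_takeP _ (leqnn _)); exists (fun j => (j == i :> nat)%:R).
  rewrite (bigD1 i) //= eqxx mul1r big1 ?addr0 // => j neq.
  by rewrite val_eqE (negPf neq) mul0r.
case: (ps_order1_mul X1 Z1 XZ3) => [X2|Z2'].
  have [|/eqP] := XY 1 0; last by rewrite oner_eq0.
  by rewrite scale1r scale0r addr0; apply/maxideal_pow_pi; exists X.
by apply: Z2; apply/maxideal_pow_pi; exists Z.
Qed.
End CompleteIntersection3.

(** * Evaluation of power series at nilpotent elements *)
Section Evaluation.
Variables (n : nat) (K : fieldType) (A : comFalgType K) (m : {vspace A}) (N :
  nat).
Hypothesis m_ideal : idealv m.
Hypothesis mpow_N : mpow m N = 0%VS.
Variable X : 'I_n -> A.
Hypothesis Xm : forall i, X i \in m.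
Local Notation R := {powerseries K[n]}.
Local Notation M := (mpow m).
Implicit Types (f g : R) (p : {mpoly K[n]}).

(** Since m^N = 0, the terms of degree at least N do not contribute. *)
Definition ps_eval f : A := mmap (in_alg A) X (ps_trunc N f).
Local Notation ev := ps_eval.

Lemma mmap_mpow p t : (forall k, (mdeg k < t)%N -> p@_k = 0)
  -> mmap (in_alg A) X p \in M t.
Proof.
move=> p0; rewrite (mmapE (msize p)) // memv_suml // => -[k _] _ /=;
  move: k => k.
have [/p0 ->|le] := ltnP (mdeg k) t; first by rewrite scale0r mul0r mem0v.
rewrite mulr_algl memvZ //; apply: memv_sub (mpow_le m_ideal le) _.
rewrite mdegE /mmap1; elim/big_ind2: _ => [|a i b j|i _].
- by rewrite memvf.
- exact: mpowM.
elim: (k i) => [|j IHj]; first by rewrite memvf.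
by rewrite exprS memv_mul.
Qed.

Lemma ps_eval_trunc f p : (forall k, (mdeg k < N)%N -> pscoef f k = p@_k) ->
  ev f = mmap (in_alg A) X p.
Proof.
move=> fp; apply/eqP; rewrite -subr_eq0 -memv0 -mpow_N -mmapB.
by apply: mmap_mpow => k lt; rewrite mcoeffB mcoeff_ps_trunc // fp // subrr.
Qed.

Lemma ps_evalM f g : ev (f * g) = ev f * ev g.
Proof.
rewrite -[RHS]rmorphM; apply: ps_eval_trunc => k lt; exact: ps_mulE.
Qed.

Lemma ps_eval_lin (c : K) f g : ev (c *: f + g) = c *: ev f + ev g.
Proof.
have <- : mmap (in_alg A) X (c *: ps_trunc N f + ps_trunc N g)
  = c *: ev f + ev g.
  by rewrite mmapD mmapZ /= mulr_algl.
by apply: ps_eval_trunc => k lt /=; rewrite mcoeffD mcoeffZ !mcoeff_ps_trunc.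
Qed.

Lemma ps_eval0 : ev 0 = 0.
Proof. by have := ps_eval_lin (-1) 0 0;
  rewrite scaler0 addr0 scaleN1r addNr. Qed.

Lemma ps_evalD f g : ev (f + g) = ev f + ev g.
Proof. by rewrite -[f]scale1r ps_eval_lin !scale1r. Qed.

Lemma ps_evalZ c f : ev (c *: f) = c *: ev f.
Proof. by rewrite -[c *: f]addr0 ps_eval_lin ps_eval0 addr0. Qed.

Lemma ps_evalB f g : ev (f - g) = ev f - ev g.
Proof. by rewrite -scaleN1r ps_evalD ps_evalZ scaleN1r. Qed.

Lemma ps_eval_sum (J : Type) (r : seq J) (P : pred J) (F : J -> R) :
  ev (\sum_(i <- r | P i) F i) = \sum_(i <- r | P i) ev (F i).
Proof. exact: (big_morph ev ps_evalD ps_eval0). Qed.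

Lemma ps_eval1 : ev 1 = 1.
Proof.
by rewrite -(rmorph1 (mmap (in_alg A) X)); apply: ps_eval_trunc => k _;
  rewrite mcoeff1.
Qed.

Lemma ps_evalX i : ev (psX K i) = X i.
Proof.
transitivity (mmap (in_alg A) X 'X_[U_(i)]); last by rewrite mmapX mmap1U.
by apply: ps_eval_trunc => k _; rewrite mcoeffX eq_sym.
Qed.

Lemma ps_eval_mpow t f : ps_order_ge t f -> ev f \in M t.
Proof.
move=> ft; apply: mmap_mpow => k lt; have [ltN|leN] := ltnP (mdeg k) N.
  by rewrite mcoeff_ps_trunc // ft.
by rewrite mcoeff_ps_trunc_ge.
Qed.

Lemma ps_eval_image t : exists V : {vspace A}, forall b, b \in V
  <-> exists2 f, ps_order_ge t f & b = ev f.
Proof.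
pose S b := exists2 f, ps_order_ge t f & b = ev f.
have [||V SV] := @vspace_of_set K A S.
- by exists 0; rewrite ?ps_eval0 //; apply: ps_order_ge_zero.
- move=> c _ _ [f ft ->] [g gt ->]; exists (c *: f + g);
    rewrite ?ps_eval_lin //.
  by apply: ps_order_geD => //; apply: ps_order_geZ.
by exists V => b; rewrite -[is_true _]/(vset V b) -SV.
Qed.

Lemma ps_eval_ideal : exists J : idealr R, forall f, f \in J = (ev f == 0).
Proof.
have closed : idealr_closed (fun f => ev f == 0).
  split=> [||a u v].
  - by rewrite unfold_in ps_eval0.
  - by rewrite unfold_in ps_eval1 oner_eq0.
  - by rewrite !unfold_in ps_evalD ps_evalM => /eqP -> /eqP ->;
      rewrite mulr0 addr0.
by exists (HB.pack_for (idealr R) (fun f => ev f == 0) (isIdealr.Build R _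
  closed)).
Qed.

End Evaluation.

(** * The subalgebra generated by x and y *)
Section FiniteDimensionalTarget.
Variables (K : fieldType) (A : comFalgType K) (Q : comAlgType K) (psi : Q -> A).
Hypothesis psi_lin : forall (c : K) x y, psi (c *: x + y) = c *: psi x + psi y.
Hypothesis psi_inj : forall x y, psi x = psi y -> x = y.

Let psiB x y : psi (x - y) = psi x - psi y.
Proof. by rewrite addrC -scaleN1r psi_lin scaleN1r addrC. Qed.

Let psi0 : psi 0 = 0.
Proof. by rewrite -(subrr 0) psiB subrr. Qed.

Let psi_sum (J : Type) (r : seq J) (c : J -> K) (F : J -> Q) :
  psi (\sum_(i <- r) c i *: F i) = \sum_(i <- r) c i *: psi (F i).
Proof.
by elim: r => [|i r IHr]; rewrite ?big_nil ?psi0 // !big_cons psi_lin IHr.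
Qed.

Lemma quotient_dim_preim (U W : set Q) (U' W' : {vspace A}) d :
  (forall q, U q <-> psi q \in U') -> (forall q, W q <-> psi q \in W') ->
  (forall b, b \in U' -> exists q, b = psi q) ->
  quotient_dim (vset U') (vset W') d -> quotient_dim U W d.
Proof.
move=> UU' WW' surj [e [eU' eP]].
have /choice[E EP] i : exists q, e i = psi q by apply: surj; apply: eU'.
exists E; split=> [i|x /UU' Ux]; first by apply/UU'; rewrite -EP; apply: eU'.
have WE (c : 'rV[K]_d) : W (x - \sum_i c 0 i *: E i)
  <-> vset W' (psi x - \sum_i c 0 i *: e i).
  rewrite WW' psiB psi_sum; under eq_bigr do rewrite -EP.
  by [].
have [c [cW c_uniq]] := eP _ Ux.
by exists c; split=> [|c' /WE]; [apply/WE | apply: c_uniq].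
Qed.

Lemma artinian_finite_dim : artinian Q.
Proof.
move=> F idF decF.
have /choice[V VP] i : exists V : {vspace A}, [set b | exists2 q, F i q & b
  = psi q]%classic = vset V.
  have [F0 FD FM] := idF i.
  apply: vspace_of_set; first by exists 0.
  move=> c _ _ [x Fx ->] [y Fy ->]; exists (c *: x + y) => //.
  by apply: FD => //; rewrite -mulr_algl; apply: FM.
have FV i q : F i q <-> psi q \in V i.
  rewrite -[is_true _]/(vset (V i) (psi q)) -VP /=;
    split=> [Fq|[q' Fq' /psi_inj ->]] //.
  by exists q.
have decV i j : (i <= j)%N -> (V j <= V i)%VS.
  move=> /subnK <-; apply/subvP=> b; rewrite -[is_true _]/(vset (V _) b) -VP
    => -[q Fq ->].
  apply/FV; elim: (j - i)%N Fq => // k IHk; rewrite addSn => /decF; exact: IHk.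
have exd : exists d, `[< exists i, \dim (V i) = d >] by exists (\dim (V 0%N));
  apply/asboolP; exists 0%N.
case: (ex_minnP exd) => d /asboolP[N dN] mind; exists N => i leNi.
apply/seteqP; split=> q; rewrite /= !FV; first exact/memv_sub/decV.
suff /eqP -> : V i == V N by [].
by rewrite eqEdim decV // dN; apply: mind; apply/asboolP; exists i.
Qed.
End FiniteDimensionalTarget.

(** The space V t is the image under evaluation at (x, y) of the series of
    order at least t, that is, the t-th power of the maximal ideal of the
    subalgebra generated by x and y. It is shown to be m^t for t >= 2, and to be
    a complement of <z> in m for t = 1. *)
Section Subalgebra.
Variables (K : fieldType) (A : comFalgType K) (m : {vspace A}) (s : nat) (h :
  nat -> nat).
Hypothesis G : local_gorenstein m s h.
Hypothesis h1 : h 1%N = 3%N.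
Hypothesis s3 : (2 < s)%N.
Variables (x y z : A).
Hypothesis B : connected_sum_basis m s x y z.
Local Notation M := (mpow m).
Local Notation R := {powerseries K[2]}.

Let X (i : 'I_2) : A := if i == 0 then x else y.
Local Notation ev := (ps_eval s.+1 X).

Let mI : idealv m := lg_ideal G.
Let ms1 : M s.+1 = 0%VS := lg_s1 G.

Let Xm i : X i \in m.
Proof. by rewrite /X; case: ifP => _; [apply: cs_x B | apply: cs_y B]. Qed.

Lemma eval_mul_z f : ps_order_ge 1 f -> ev f * z = 0.
Proof.
case/ps_order_geS => g [_ ->].
rewrite (ps_eval_sum mI ms1 Xm) mulr_suml big1 // => i _.
rewrite (ps_evalM mI ms1 Xm) mulrAC (ps_evalX mI ms1 Xm) /X.
by case: ifP => _; rewrite ?(cs_xz B) ?(cs_yz B) mul0r.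
Qed.

Section Images.
Variable V : nat -> {vspace A}.
Hypothesis VP : forall t b, b \in V t <-> exists2 f, ps_order_ge t f & b = ev f.

Let VM t : (V t <= M t)%VS.
Proof. by apply/subvP=> b /VP[f ft ->]; apply: ps_eval_mpow. Qed.

Let V_mul i j a b : a \in V i -> b \in V j -> a * b \in V (i + j).
Proof.
move=> /VP[f fi ->] /VP[g gj ->]; apply/VP; exists (f * g);
  first exact: ps_order_geM.
by rewrite (ps_evalM mI ms1 Xm).
Qed.

Let V_le i j : (i <= j)%N -> (V j <= V i)%VS.
Proof.
move=> le; apply/subvP=> b /VP[f fj ->]; apply/VP; exists f => //.
exact: ps_order_ge_le fj.
Qed.

Let V1z a : a \in V 1 -> a * z = 0.
Proof. by case/VP => f f1 ->; apply: eval_mul_z. Qed.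

Let xV : x \in V 1.
Proof.
apply/VP; exists (psX K 0); last by rewrite (ps_evalX mI ms1 Xm).
exact: ps_order_ge1_psX.
Qed.

Let yV : y \in V 1.
Proof.
apply/VP; exists (psX K 1); last by rewrite (ps_evalX mI ms1 Xm).
exact: ps_order_ge1_psX.
Qed.

(* V 1 + <z> is what m will turn out to be; adding <z * z> makes the space
   visibly closed under products, before z * z is known to be in V 1. *)
Let P := (V 1 + <[z]> + <[z * z]>)%VS.

Let Mm2 a b : a \in m -> b \in m -> a * b \in M 2.
Proof. by move=> am bm; apply: (mpowM mI (i := 1) (j := 1));
  rewrite (mpow1 mI). Qed.

Let zm := cs_z B.

Let zzz : z * z * z = 0.
Proof. by apply: (cs_m2z B); apply: Mm2. Qed.

Let Pm : (P <= m)%VS.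
Proof.
by rewrite !subv_add -(mpow1 mI) VM (mpow1 mI) -!memvE zm mI.
Qed.

Let inP w : w \in P -> exists a c d, a \in V 1 /\ w = a + c *: z + d *: (z * z).
Proof.
case/memv_addP=> w1 /memv_addP[a aV [_ /vlineP[c ->] ->]] [_ /vlineP[d ->] ->].
by exists a, c, d.
Qed.

Let P_mul a b : a \in P -> b \in P -> exists a' c, a' \in V 2 /\ a * b
  = a' + c *: (z * z).
Proof.
move=> /inP[a1 [c1 [d1 [a1V ->]]]] /inP[a2 [c2 [d2 [a2V ->]]]].
exists (a1 * a2), (c1 * c2); split; first exact: (V_mul (i := 1) (j := 1)).
have z2z : z * (z * z) = 0 by rewrite mulrA zzz.
have a1z := V1z a1V; have a2z := V1z a2V.
have za : z * a2 = 0 by rewrite mulrC.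
have azz r : r * z = 0 -> r * (z * z) = 0 by move=> az; rewrite mulrA az mul0r.
have zza : z * z * a2 = 0 by rewrite mulrC azz.
rewrite !(mulrDl, mulrDr) -!(scalerAl, scalerAr).
rewrite a1z za zza (azz a1) // z2z zzz -[z * z * (z * z)]mulrA z2z mulr0
  !scaler0.
by rewrite !(addr0, add0r) scalerA.
Qed.

(* As m = P + m^2, successive approximation gives m = P + m^t for all t, and
   m is nilpotent. *)
Let m_sub_P t : (m <= P + M t)%VS.
Proof.
elim: t => [|t IHt]; first by rewrite addvf subvf.
have m2 : (M 2 <= P + M t.+1)%VS.
  apply/prodvP=> a b am; rewrite -/(mpow m 1) (mpow1 mI) => bm.
  have /memv_addP[a1 a1P [a2 a2t ->]] := memv_sub IHt am.
  have /memv_addP[b1 b1P [b2 b2t def_b]] := memv_sub IHt bm.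
  rewrite mulrDl [a1 * b]mulrC {1}def_b mulrDl.
  have a1m := memv_sub Pm a1P.
  rewrite -addrA memv_add //.
    have [b' [c [b'V ->]]] := P_mul b1P a1P.
    rewrite memvD //; last by rewrite memvZ //;
      apply: memv_sub (addvSr _ _) (memv_line _).
    rewrite /P -addvA; apply: memv_sub (addvSl _ _) _.
    exact: memv_sub (V_le (isT : 1 <= 2)%N) b'V.
  rewrite memvD // mulrC memv_mul //.
have V1P : (V 1 <= P)%VS by rewrite /P -addvA addvSl.
have zP : z \in P.
  by rewrite /P; apply: memv_sub (addvSl _ _) (memv_sub (addvSr _ _) (memv_line
    z)).
have inPM r : r \in P -> r \in (P + M t.+1)%VS by apply/memv_sub/addvSl.
rewrite {1}(cs_gen B) !subv_add m2 -!memvE (inPM z) // (inPM x) ?(inPM y) //.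
  exact: memv_sub yV.
exact: memv_sub xV.
Qed.

Let mE : (m <= P)%VS.
Proof. by have := m_sub_P s.+1; rewrite ms1 addv0. Qed.

(** A product of three elements of P = V 1 + <z> + <z * z> is a product of three
    elements of V 1, since z kills V 1 and z^3 = 0. *)
Lemma image_mpow3 t : (2 < t)%N -> (M t <= V t)%VS.
Proof.
case: t => [|[|[|t]]] // _; elim: t => [|t IHt];
  apply/prodvP=> a b /(memv_sub mE)/inP[a1 [c [d [a1V ->]]]] bM.
  have : b \in (V 2 + <[z * z]>)%VS.
    move: b bM; apply: prodv_ind => [|k b b' bV b'V|b b' bm];
      first exact: mem0v.
      by rewrite memvD ?memvZ.
    rewrite -/(mpow m 1) (mpow1 mI) => b'm.
    have [w [k [wV ->]]] := P_mul (memv_sub mE bm) (memv_sub mE b'm).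
    by rewrite memv_add ?memvZ ?memv_line.
  case/memv_addP=> w wV [_ /vlineP[k ->] ->].
  have w1 : w \in V 1 by apply: memv_sub (V_le _) wV.
  rewrite !(mulrDl, mulrDr) -!(scalerAl, scalerAr).
  rewrite ![_ * w]mulrC mulrA !(mulrA _ z z) (V1z w1) (V1z a1V) zzz !mul0r
    !scaler0 !addr0 mulrC.
  exact: (V_mul (i := 1) (j := 2)).
have bV : b \in V t.+3 by apply: memv_sub IHt bM.
have b1 : b \in V 1 by apply: memv_sub (V_le _) bV.
rewrite mulrDl mulrDl -!scalerAl [z * b]mulrC mulrAC [z * b]mulrC (V1z b1)
  mul0r !scaler0 !addr0.
exact: (V_mul (i := 1)).
Qed.

Let z2V t : (t <= s)%N -> z * z \in V t.
Proof.
move=> ts; apply: memv_sub (V_le ts) _;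
  apply: memv_sub (image_mpow3 s3) (cs_z2 B).
Qed.

(** In degree 2 only z * z has to be accounted for; it lies in m^s, and
    m^s = V s because s >= 3. *)
Lemma image_mpow t : (1 < t)%N -> V t = M t.
Proof.
rewrite leq_eqVlt => /orP[/eqP <-|t2]; apply/eqP; rewrite eqEsubv VM //=;
  last exact: image_mpow3.
apply/prodvP=> b b' bm; rewrite -/(mpow m 1) (mpow1 mI) => b'm.
have [w [k [wV ->]]] := P_mul (memv_sub mE bm) (memv_sub mE b'm).
by rewrite memvD ?memvZ ?z2V // ltnW.
Qed.

Lemma image1_add : (V 1 + <[z]>)%VS = m.
Proof.
apply/eqP; rewrite eqEsubv; apply/andP; split.
  by rewrite subv_add -memvE zm -(mpow1 mI) VM.
apply/subvP=> a /(memv_sub mE); rewrite /P addvC addvA => aP.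
move: aP; rewrite [(<[z * z]> + _)%VS](addv_idPr _) // -memvE z2V //.
exact: ltnW (ltnW s3).
Qed.

Lemma z_notin_image1 : z \notin V 1.
Proof.
apply: contra (cs_nz B) => /VP[f f1 ->].
rewrite -(subrK (\sum_i pscoef f U_(i)%MM *: psX K i) f) (ps_evalD mI ms1 Xm).
rewrite -addvA memv_add //; first by apply: ps_eval_mpow => //;
  apply: ps_linear_part.
rewrite (ps_eval_sum mI ms1 Xm) !big_ord_recl big_ord0 addr0 /=.
by rewrite !(ps_evalZ mI ms1 Xm) !(ps_evalX mI ms1 Xm) memv_add ?memvZ
  ?memv_line.
Qed.

Lemma image0E : V 0 = (1 + V 1)%VS.
Proof.
apply/eqP; rewrite eqEsubv; apply/andP; split.
  apply/subvP=> _ /VP[f _ ->]; rewrite -(subrK (pscoef f 0%MM *: 1) f) addrC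
    (ps_evalD mI ms1 Xm).
  rewrite (ps_evalZ mI ms1 Xm) (ps_eval1 mI ms1 Xm) memv_add ?memvZ ?memv_line
    //.
  apply/VP; exists (f - pscoef f 0%MM *: 1) => //.
  by apply/ps_order_ge1; rewrite /= eqxx mulr1 subrr.
rewrite subv_add V_le // -memvE andbT; apply/VP; exists 1 => //.
by rewrite (ps_eval1 mI ms1 Xm).
Qed.

Lemma dim_image1 : (\dim (V 1) + 1)%N = \dim m.
Proof. by rewrite -image1_add dimv_add_line_notin // z_notin_image1. Qed.

Lemma dim_image0 : \dim (V 0) = (\dim (V 1) + 1)%N.
Proof.
rewrite image0E addvC dimv_add_line_notin //; apply/negP => /VP[f f1 e].
have /negP[] : 1 \notin m.
  by apply/negP => /(m_notunit (lg_mP G)) => /(_ 1); rewrite mulr1.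
by rewrite e -(mpow1 mI); apply: ps_eval_mpow.
Qed.
End Images.
End Subalgebra.

(** J is the kernel of the evaluation of power series at (x, y). Everything is
    transported along the injection psi of K[[x, y]]/J into A, whose image
    misses z only: the Hilbert function drops by 1 in degree 1, and an element
    of the image that kills x and y also kills z, so it is in the socle of A. *)
Lemma connected_sum_summand (K : fieldType) (A : comFalgType K) (m : {vspace
  A}) s h (x y z : A) :
  local_gorenstein m s h -> h 1%N = 3%N -> (2 < s)%N
    -> connected_sum_basis m s x y z ->
  exists J : idealr {powerseries K[2]},
    gorenstein_ideal J /\ hilbert_function {ideal_quot J} (fun i
      => (h i - delta i)%N).
Proof.
move=> G h1 s3 B; have mI := lg_ideal G; have ms1 := lg_s1 G;
  have mP := lg_mP G.
pose X (i : 'I_2) : A := if i == 0 then x else y.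
have Xm i : X i \in m by rewrite /X; case: ifP => _;
  [apply: cs_x B | apply: cs_y B].
pose ev := @ps_eval 2 K A s.+1 X.
have [J JP] := ps_eval_ideal mI ms1 Xm; rewrite -/ev in JP.
have /choice[V VP] t := ps_eval_image mI ms1 Xm t; rewrite -/ev in VP.
pose psi (q : {ideal_quot J}) := ev (repr q).
have psi_pi f : psi (iq_pi J f) = ev f.
  apply/eqP; rewrite -subr_eq0 -(ps_evalB mI ms1 Xm) -/ev -JP -iq_pi_eq0 iq_piB
    subr_eq0.
  by rewrite /iq_pi reprK.
have psi_lin (c : K) p q : psi (c *: p + q) = c *: psi p + psi q.
  have [f ->] := iq_pi_surj p; have [g ->] := iq_pi_surj q.
  by rewrite -iq_piZ -iq_piD !psi_pi /ev (ps_eval_lin mI ms1 Xm).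
have psi_inj p q : psi p = psi q -> p = q.
  have [f ->] := iq_pi_surj p; have [g ->] := iq_pi_surj q;
    rewrite !psi_pi => /eqP.
  rewrite -subr_eq0 -(ps_evalB mI ms1 Xm) -/ev -JP -iq_pi_eq0 iq_piB subr_eq0.
  by move/eqP.
have powP t q : maxideal_pow {ideal_quot J} t q <-> psi q \in V t.
  rewrite maxideal_pow_pi VP; split=> -[f ft e]; exists f => //.
    by rewrite e psi_pi.
  by apply: psi_inj; rewrite psi_pi.
have V_surj t b : b \in V t -> exists q, b = psi q.
  by case/VP=> f _ ->; exists (iq_pi J f); rewrite psi_pi.
have VM t : (1 < t)%N -> V t = mpow m t by apply: (image_mpow G s3 B VP).
have d1 := dim_image1 G s3 B VP; have d0 := dim_image0 G B VP.
have V_le t : (V t.+1 <= V t)%VS.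
  by apply/subvP=> b /VP[f ft ->]; apply/VP; exists f => //;
    apply: ps_order_ge_le ft.
exists J; split; last first.
  move=> t; apply: (quotient_dim_preim psi_lin (powP t) (powP t.+1) (@V_surj
    t)).
  apply/quotient_dimP => //; case: t => [|[|t]].
  - have h0 := lg_hf G 0; have res := lg_res G; rewrite d0 /delta subn0.
    by move: h0 res; rewrite (mpow1 mI) /=; clear; lia.
  - by have := lg_hf G 1; rewrite (mpow1 mI) VM // h1 /delta -d1 /=; clear; lia.
  - by rewrite !VM // subn0; apply: lg_hf G _.
split; first exact: artinian_finite_dim psi_lin psi_inj.
  exact: local_ring_iq.
have socE : annv m = V s.
  by rewrite VM; [apply: socle_eq ms1 (lg_s G) (lg_soc G) | lia].
have xV : x \in V 1%N.
  apply/VP; exists (psX K 0); last by rewrite /ev (ps_evalX mI ms1 Xm).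
  exact: ps_order_ge1_psX.
apply: (quotient_dim_preim psi_lin (U' := annv m) (W' := 0%VS)).
- move=> q; split=> [qann|/annvP qann].
    have qV1 b : b \in V 1%N -> psi q * b = 0.
      move=> bV; have /VP[f f1 ->] := bV; have [g def_q] := iq_pi_surj q.
      have := qann (iq_pi J f); rewrite def_q psi_pi -(ps_evalM mI ms1 Xm)
        -iq_piM.
      move=> /(_ (proj2 (nonunits_pi J f) f1))/eqP;
        rewrite iq_pi_eq0 JP => /eqP. by [].
    apply/annvP=> b; rewrite -(image1_add G s3 B VP)
      => /memv_addP[b1 b1V [_ /vlineP[c ->] ->]].
    rewrite mulrDr qV1 // add0r -scalerAr.
    suff -> : psi q * z = 0 by rewrite scaler0.
    have [g def_q] := iq_pi_surj q; rewrite def_q psi_pi.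
    apply: (eval_mul_z G B); apply/(nonunits_pi J); rewrite -def_q => -[r qr].
    case/negP: (cs_nx B); suff -> : x = 0 by apply: mem0v.
    have psiM p p' : psi (p * p') = psi p * psi p'.
      have [f ->] := iq_pi_surj p; have [f' ->] := iq_pi_surj p'.
      by rewrite -iq_piM !psi_pi /ev (ps_evalM mI ms1 Xm).
    have psi1 : psi 1 = 1 by rewrite -(iq_pi1 J) psi_pi /ev (ps_eval1 mI ms1
      Xm).
    by rewrite -[x]mulr1 -psi1 -qr psiM mulrA [x * _]mulrC qV1 // mul0r.
  move=> p np; have [f def_p] := iq_pi_surj p; have [g def_q] := iq_pi_surj q.
  move: np qann; rewrite def_p def_q psi_pi => /nonunits_pi f1 qann.
  apply/eqP; rewrite -iq_piM iq_pi_eq0 JP /ev (ps_evalM mI ms1 Xm);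
    apply/eqP/qann.
  by rewrite -(mpow1 mI); apply: ps_eval_mpow.
- move=> q; rewrite memv0; split=> [->|/eqP q0].
    by rewrite -(rmorph0 (\pi_({ideal_quot J}))%qT) -/(iq_pi J 0) psi_pi /ev
      (ps_eval0 mI ms1 Xm).
  apply: psi_inj; rewrite q0.
  by rewrite -(rmorph0 (\pi_({ideal_quot J}))%qT) -/(iq_pi J 0) psi_pi /ev
    (ps_eval0 mI ms1 Xm).
- by rewrite socE => b; apply: V_surj.
- by apply/quotient_dimP; rewrite ?sub0v // dimv0 (lg_soc G).
Qed.

(** * The theorem *)
Section HilbertVector.
Local Open Scope nat_scope.
Lemma h_vecE u v w i : h_vec u v w i = h_par u v w 1 i.
Proof.
rewrite /h_vec /h_seq; case: i => [|[|[|i]]] //=;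
  first by rewrite /h_par /= ifT //; lia.
rewrite !nth_cat !size_nseq !nth_nseq /h_par /=.
case: ltnP => [lt|le].
  by have -> : i.+3 <= u + 2 by lia.
have -> : i.+3 <= u + 2 = false by lia.
case: ltnP => [lt2|le2].
  by have -> : i.+3 <= u + v + 2 by lia.
have -> : i.+3 <= u + v + 2 = false by lia.
case: ltnP => [lt3|le3].
  by have -> : i.+3 <= u + v + w + 3 by lia.
have [e|i0] := eqVneq (i - u - v - w)%N 0%N.
  by rewrite e; have -> : i.+3 <= u + v + w + 3 by lia.
have -> : i.+3 <= u + v + w + 3 = false by lia.
by rewrite nth_default //= lt0n.
Qed.

Lemma h_par_delta u v w : (fun i => h_par u v w 1 i - delta i) = h_par u v w 0.
Proof. by apply/funext => -[|[|i]] //=; rewrite subn0. Qed.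

End HilbertVector.

Section Dichotomy.
Variables (K : fieldType) (A : comAlgType K) (u v w : nat).
Let s := (u + v + w + 3)%N.
Hypothesis gorA : artinian_gorenstein A.

Lemma local_gorenstein_h_par e : hilbert_function A (h_par u v w e) ->
  exists (B : comFalgType K) (m : {vspace B}),
    B = A :> comAlgType K /\ local_gorenstein m s (h_par u v w e).
Proof.
move=> HF; apply: local_gorensteinP gorA HF _ _ _ => //.
  by rewrite h_par_one //; rewrite /s; lia.
by move=> i lt; rewrite h_par_gt.
Qed.

(** For h - delta the alternative leading to D1 is excluded by h(1) = 2. *)
Lemma codim2_decomposition : (0 < v)%N -> hilbert_function A (h_par u v w 0) ->
  symmetric_decomposition A (D2_codim2 u v w).
Proof.
move=> v0 /local_gorenstein_h_par[B [m [eqA G]]]; case: A / eqA.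
apply: (symmetric_decomposition_sdec G) => a i _.
have ve : v = 0%N -> 0%N = 1%N by move=> vE; rewrite vE in v0.
by have [[]//|[_ ->]] := sdec_dichotomy (leq0n 1) ve G;
  rewrite mul0n muln0 addn0.
Qed.

Lemma codim3_dichotomy : hilbert_function A (h_par u v w 1) ->
  (symmetric_decomposition A (D1 u v w) /\
   forall D, symmetric_decomposition A D ->
     forall a i, (a.+2 <= s)%N -> D a i = D1 u v w a i) \/
  [/\ (0 < v)%N, symmetric_decomposition A (D2 s (D2_codim2 u v w)),
      not_two_generated A, killed_linear_form A &
      exists J : idealr {powerseries K[2]}, gorenstein_ideal J /\
        hilbert_function {ideal_quot J} (h_par u v w 0)].
Proof.
move=> /local_gorenstein_h_par[B [m [eqA G]]]; case: A / eqA.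
have [[_ decE]|[v0 decE]] := sdec_dichotomy (leqnn 1) (fun=> erefl) G.
  left; split; first by apply: (symmetric_decomposition_sdec G) => a i _;
    rewrite decE.
  by move=> D /(symmetric_decomposition_uniq G) DE a i le; rewrite DE // decE.
right.
have s3 : (2 < s)%N by rewrite /s; lia.
have dec1 : sdec m s (s - 2) 1 = 1%N.
  rewrite decE /D2_codim2 eqxx mul1n /delta /=.
  have -> : (s - 2 == 0)%N = false by rewrite /s; lia.
  have -> : (s - 2 == w)%N = false by rewrite /s; lia.
  by have -> : (s - 2 == w + v - 1)%N = false by rewrite /s; lia.
have [x [y [z C]]] := connected_sum G (ltnW s3) erefl dec1.
have mP := lg_mP G; have mI := lg_ideal G.
have dim_m : \dim m = (\dim (mpow m 2) + 3)%N.
  by have := lg_hf G 1; rewrite (mpow1 mI).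
split=> //.
- apply: (symmetric_decomposition_sdec G) => a i _.
  by rewrite decE /D2 mul1n.
- move=> g; have [t [tm tN]] : exists t, t \in m /\ t \notin (mpow m 2
    + <[g ord0]> + <[g (lift ord0 ord0)]>)%VS.
    apply: contrapT => no; have /dimvS : (m <= mpow m 2 + <[g ord0]>
      + <[g (lift ord0 ord0)]>)%VS.
      by apply/subvP=> t tm; apply: contraT => tN; case: no; exists t.
    rewrite dim_m => le3; have := leq_trans le3 (dimv_add_line _ _).
    have := dimv_add_line (mpow m 2) (g ord0).
    by move: (\dim (mpow m 2 + _)%VS) (\dim (mpow m 2)); lia.
  exists t; first by rewrite mP.
  move=> c; rewrite (maxideal_pow_vset mP) => tc; case/negP: tN.
  rewrite -(subrK (\sum_i c i *: g i) t) -addvA memv_add //.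
  by rewrite !big_ord_recl big_ord0 addr0 memv_add // memvZ // memv_line.
- exists x, y, z; rewrite !mP !(maxideal_pow_vset mP); split.
    by split; [apply: cs_x C | apply: cs_y C | apply: cs_z C].
  split; [exact: cs_xz C | exact: cs_yz C | |].
    move=> z2; case/negP: (cs_nz C); rewrite -addvA;
      exact: memv_sub (addvSl _ _) z2.
  move=> a b; rewrite /vset /= => abM.
  have b0 : b = 0.
    apply/eqP; apply: contraT => nb; case/negP: (cs_ny C).
    rewrite -[y]scale1r -(mulVf nb) -scalerA memvZ //.
    rewrite -[b *: y](addKr (a *: x)) addrC memv_add //.
    by rewrite memvN memvZ // memv_line.
  split=> //; apply/eqP; apply: contraT => na; case/negP: (cs_nx C).
  move: abM; rewrite b0 scale0r addr0 => aM.
  by rewrite -[x]scale1r -(mulVf na) -scalerA memvZ.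
- have [J [gorJ HFJ]] := connected_sum_summand G erefl s3 C.
  by exists J; rewrite -h_par_delta.
Qed.
End Dichotomy.

Lemma Delta_le1 u v w : (0 < v)%N -> (Delta (u + v + w
  + 3) (h_par u v w 1) <= 1)%N.
Proof.
move=> v0; rewrite /Delta big_nat; elim/big_ind: _ => // [p q|i].
  by rewrite geq_max => -> ->.
move=> i3; have [lt1|le1] := leqP i (u + 2).
  by rewrite !h_par_3 ?distnn; lia.
have [lt2|le2] := leqP i (u + v + 2).
  rewrite h_par_2 //; have [e|ne] := eqVneq i (u + 3)%N.
    by rewrite h_par_3; lia.
  by rewrite h_par_2; lia.
rewrite h_par_one; try lia.
have [e|ne] := eqVneq i (u + v + 3)%N; first by rewrite h_par_2; lia.
by rewrite h_par_one; lia.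
Qed.

Local Close Scope ring_scope.

Theorem proposition5p1 (K : fieldType) (u v w : nat)
    (I : idealr {powerseries K[3]}) :
  let h := h_vec u v w in
  let s := u + v + w + 3 in
  O_sequence h ->
  gorenstein_ideal I ->
  hilbert_function {ideal_quot I} h ->
  [/\ complete_intersection_ideal I ->
        symmetric_decomposition {ideal_quot I} (D1 u v w) /\
        (forall D, symmetric_decomposition {ideal_quot I} D ->
           forall a i, a <= s - 2 -> D a i = D1 u v w a i),
      Delta s h = 2 ->
        symmetric_decomposition {ideal_quot I} (D1 u v w)
    & Delta s h = 1 ->
        symmetric_decomposition {ideal_quot I} (D1 u v w) \/
        exists D, unique_symmetric_decomposition2 K (fun i
          => h i - delta i) D /\
          symmetric_decomposition {ideal_quot I} (D2 s D)].
Proof.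
move=> h s _ gorI.
have -> : h = h_par u v w 1 by apply/funext => i; apply: h_vecE.
rewrite h_par_delta => HF.
have [[dec uniq]|[v0 dec ntg klf [J [gorJ HFJ]]]] := codim3_dichotomy gorI HF.
  split=> [_|//|_]; last by left.
  by split=> // D decD a i le; apply: uniq => //; rewrite /s in le; lia.
split=> [ci|Delta2|_].
- by case: (killed_linear_form_not_ci ntg klf ci).
- by have := Delta_le1 u w v0; rewrite -/s Delta2.
right; exists (D2_codim2 u v w); split=> //; split; first by exists J.
by move=> L gorL HFL; apply: codim2_decomposition.
Qed.
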